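(* Let $K\subset\mathbb R^m$ be a closed, line-free, convex semi-algebraic set and let $\pi:\mathbb R^m\to\mathbb R^n$ be a projection, both defined over $\mathbb Q$. Suppose that $x\in K$ is locally generic in $\operatorname{ext}_k(K)$ and universally rigid under $\pi$. Then $\pi(x)$ is a $k$-exposed point of $\pi(K)$.
   Context: A projection is a surjective linear map; it is defined over $\mathbb Q$ if its matrix has rational entries. A semi-algebraic set is defined over $\mathbb Q$ if it can be described by polynomial equalities and inequalities with rational coefficients. A convex set is line-free if it contains no complete affine line. For a convex set $K$ and $x\in K$, the face $F(x)$ is the unique largest convex subset of $K$ containing $x$ in its relative interior, and $f(x)=\dim F(x)$ (the dimension of a convex set being that of its affine hull). For an integer $k\ge0$, $x\in K$ is $k$-extreme if $f(x)\le k$; $\operatorname{ext}_k(K)$ is the set of $k$-extreme points of $K$. A point $x\in K$ is $k$-exposed (in $K$) if there is a closed half-space $H$ containing $x$ with $\dim(H\cap K)\le k$. A point $x$ of a set $S\subset\mathbb R^m$ is generic in $S$ if its coordinates satisfy no polynomial equation with rational coefficients other than those satisfied by every point of $S$; $x$ is locally generic in $S$ if $x$ is generic in $S\cap B_\epsilon(x)$ for all small enough $\epsilon>0$, where $B_\epsilon(x)$ is the ball of radius $\epsilon$ about $x$. A point $x\in K$ is universally rigid under $\pi$ if $x$ is the only point of $K$ mapped by $\pi$ to $\pi(x)$. *)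

(* Defs.v *)
From HB Require Import structures.
From mathcomp Require Import all_boot all_order all_algebra.
From mathcomp Require Import all_classical all_reals all_analysis.
(* The notations of mpoly clash with those of analysis. *)
From mathcomp Require Import -(notations) mpoly.

Set Implicit Arguments.
Unset Strict Implicit.
Unset Printing Implicit Defensive.

Import Order.TTheory GRing.Theory Num.Theory.
Import numFieldNormedType.Exports.

Local Open Scope classical_set_scope.
Local Open Scope ring_scope.

(* Points of R^m are row vectors. *)

Definition qpoly_eval (R : realType) (m : nat) (p : mpoly m rat)
    (x : 'rV[R]_m) : R :=
  mmap (@ratr R) (fun i => x 0 i) p.

(* A finite union of sets {p = 0 for p in c.1, q > 0 for q in c.2}. *)
Definition semialgebraic_over_Q (R : realType) (m : nat)
    (K : set 'rV[R]_m) : Prop :=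
  exists s : seq (seq (mpoly m rat) * seq (mpoly m rat)),
    K = [set x | exists2 c, c \in s &
          (forall p, p \in c.1 -> qpoly_eval p x = 0) /\
          (forall q, q \in c.2 -> 0 < qpoly_eval q x)].

Definition linear_over_Q (R : realType) (m n : nat)
    (pi : {linear 'rV[R]_m -> 'rV[R]_n}) : Prop :=
  forall i j, exists q : rat, lin1_mx pi i j = ratr q.

Definition line_free (R : realType) (m : nat) (K : set 'rV[R]_m) : Prop :=
  ~ exists p v : 'rV[R]_m, v != 0 /\ forall t : R, K (p + t *: v).

(* Vacuously satisfied by the empty set, so that the affine hull of set0 is
   set0. *)
Definition affine_set (R : realType) (m : nat) (A : set 'rV[R]_m) : Prop :=
  forall (x y : 'rV[R]_m) (t : R), A x -> A y -> A ((1 - t) *: x + t *: y).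

Definition affine_hull (R : realType) (m : nat) (S : set 'rV[R]_m) :
    set 'rV[R]_m :=
  smallest (@affine_set R m) S.

(* A nonempty set has exactly one dimension; set0 has none. *)
Definition has_dim (R : realType) (m : nat) (S : set 'rV[R]_m) (d : nat) :
    Prop :=
  exists (x0 : 'rV[R]_m) (V : {vspace 'rV[R]_m}),
    affine_hull S = [set x0 + v | v in [set v | v \in V]] /\ \dim V = d.

Definition dim_le (R : realType) (m : nat) (S : set 'rV[R]_m) (k : nat) :
    Prop :=
  exists2 d, has_dim S d & (d <= k)%N.

Definition relative_interior (R : realType) (m : nat) (C : set 'rV[R]_m) :
    set 'rV[R]_m :=
  [set x | C x /\ \forall y \near x, affine_hull C y -> C y].

Definition convex_part_at (R : realType) (m : nat) (K : set 'rV[R]_m)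
    (x : 'rV[R]_m) (C : set 'rV[R]_m) : Prop :=
  [/\ convex_set C, C `<=` K & relative_interior C x].

(* F is the face F(x) of K: the largest of the sets C above. *)
Definition is_face_at (R : realType) (m : nat) (K : set 'rV[R]_m)
    (x : 'rV[R]_m) (F : set 'rV[R]_m) : Prop :=
  convex_part_at K x F /\ forall C, convex_part_at K x C -> C `<=` F.

Definition extreme_points (R : realType) (m : nat) (k : nat)
    (K : set 'rV[R]_m) : set 'rV[R]_m :=
  [set x | K x /\ exists2 F, is_face_at K x F & dim_le F k].

Definition closed_halfspace (R : realType) (m : nat) (H : set 'rV[R]_m) :
    Prop :=
  exists2 c : 'rV[R]_m, c != 0 &
    exists b : R, H = [set y | \sum_i c 0 i * y 0 i <= b].

Definition exposed (R : realType) (m : nat) (k : nat) (K : set 'rV[R]_m)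
    (x : 'rV[R]_m) : Prop :=
  K x /\ exists2 H, closed_halfspace H & H x /\ dim_le (H `&` K) k.

(* The library's [ball] on matrices is the ball of the sup norm. *)
Definition euclidean_ball (R : realType) (m : nat) (x : 'rV[R]_m) (e : R) :
    set 'rV[R]_m :=
  [set y | \sum_i (y 0 i - x 0 i) ^+ 2 < e ^+ 2].

Definition generic (R : realType) (m : nat) (S : set 'rV[R]_m)
    (x : 'rV[R]_m) : Prop :=
  S x /\ forall p : mpoly m rat,
    qpoly_eval p x = 0 -> forall y, S y -> qpoly_eval p y = 0.

Definition locally_generic (R : realType) (m : nat) (S : set 'rV[R]_m)
    (x : 'rV[R]_m) : Prop :=
  \forall e \near (0 : R)^'+, generic (S `&` euclidean_ball x e) x.

Definition universally_rigid (R : realType) (m n : nat) (K : set 'rV[R]_m)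
    (pi : {linear 'rV[R]_m -> 'rV[R]_n}) (x : 'rV[R]_m) : Prop :=
  K x /\ forall y, K y -> pi y = pi x -> y = x.

(* Main.v *)
Require Import Defs.
From HB Require Import structures.
From mathcomp Require Import all_boot all_order all_algebra.
From mathcomp Require Import all_classical all_reals all_analysis.
From mathcomp Require Import -(notations) mpoly.
From mathcomp Require ordered_qelim qe_rcf_th qe_rcf.
From mathcomp Require Import ring lra.

Set Implicit Arguments.
Unset Strict Implicit.
Unset Printing Implicit Defensive.

Import Order.TTheory GRing.Theory Num.Theory.
Import numFieldNormedType.Exports.

Local Open Scope classical_set_scope.
Local Open Scope ring_scope.

(* A point of K is k-extreme when the directions in which K extends on both sides
   of it span a space of dimension at most k. The image of K is compact near pi(x)
   because x is universally rigid, and pi(x) is k-extreme in it. By Asplund's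
   theorem pi(x) is a limit of k-exposed points y of pi(K); a point of maximal norm
   in the fibre of K over y is k-extreme in K and close to x. So x is a limit of
   k-extreme points z of K such that pi(z) is k-exposed. The condition on z is
   first-order over Q, hence semialgebraic over Q by Tarski and Seidenberg, and it
   passes to the limit x: if a polynomial occurring in one of its strict
   inequalities vanished at x, then, x being locally generic, it would vanish at all
   k-extreme points near x.

   For Asplund's theorem, let p be k-extreme in a compact convex set C and choose at
   most k coordinates J that separate the points of the face of p. Maximizers y of
   <b, z - p> - |(z - p)_J|^2 / 2 are close to p for all b in an open ball, and y
   lies in the face exposed by c = b - (y - p)_J. If this face has dimension more
   than k, then c plus some point z of it lies in one of countably many rational
   flats of codimension more than k, and b is a Lipschitz function of z + c and
   (y - p)_J, hence of fewer than n parameters; by Baire's theorem some b avoids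
   all these nowhere dense sets. *)

(** * Rationality of the constants in quantifier elimination *)

Section RationalFormulas.
Variable F : rcfType.
Implicit Types (t : qe_rcf.term F) (f : qe_rcf.formula F).
Implicit Types (p q : qe_rcf.polyF F).

Definition ratr_const (c : F) : Prop := exists q : rat, c = ratr q.

(* The library proves quantifier elimination over a real closed field without
   control of the constants of the output; these predicates track that all of
   them are rational. *)
Fixpoint rat_term t : Prop :=
  match t with
  | qe_rcf.Const c => ratr_const c
  | qe_rcf.Add u v | qe_rcf.Mul u v => rat_term u /\ rat_term v
  | qe_rcf.Opp u | qe_rcf.NatMul u _ | qe_rcf.Exp u _ => rat_term u
  | _ => True
  end.

Fixpoint rat_formula f : Prop :=
  match f with
  | qe_rcf.Bool _ => True
  | qe_rcf.Equal u v | qe_rcf.Lt u v | qe_rcf.Le u v =>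
      rat_term u /\ rat_term v
  | qe_rcf.And g h | qe_rcf.Or g h | qe_rcf.Implies g h =>
      rat_formula g /\ rat_formula h
  | qe_rcf.Not g => rat_formula g
  end.

Definition rat_poly p : Prop := List.Forall rat_term p.

Definition rat_polys (ps : seq (qe_rcf.polyF F)) : Prop :=
  List.Forall rat_poly ps.

Lemma ratr_const0 : ratr_const 0. Proof. by exists 0; rewrite raddf0. Qed.

Lemma ratr_const1 : ratr_const 1. Proof. by exists 1; rewrite rmorph1. Qed.

Lemma ratr_constN c : ratr_const c -> ratr_const (- c).
Proof. by case=> q ->; exists (- q); rewrite raddfN. Qed.

Lemma ratr_const_int (n : int) : ratr_const n%:~R.
Proof. by exists n%:~R; rewrite ratr_int. Qed.

Lemma ratr_constV c : ratr_const c -> ratr_const c^-1.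
Proof. by case=> q ->; exists q^-1; rewrite fmorphV. Qed.

Lemma rat_poly_nil : rat_poly [::]. Proof. exact: List.Forall_nil. Qed.
Hint Resolve rat_poly_nil : core.

Lemma rat_poly_cons t p : rat_term t -> rat_poly p -> rat_poly (t :: p).
Proof. exact: List.Forall_cons. Qed.

Lemma rat_polyW t p : rat_poly (t :: p) -> rat_term t /\ rat_poly p.
Proof. by move=> /List.Forall_cons_iff. Qed.

Lemma rat_polys_cons p ps : rat_poly p -> rat_polys ps -> rat_polys (p :: ps).
Proof. exact: List.Forall_cons. Qed.

Lemma rat_polysW p ps : rat_polys (p :: ps) -> rat_poly p /\ rat_polys ps.
Proof. by move=> /List.Forall_cons_iff. Qed.

Lemma rat_polys_nil : rat_polys [::]. Proof. exact: List.Forall_nil. Qed.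
Hint Resolve rat_polys_nil : core.

Lemma rat_If f g h : rat_formula f -> rat_formula g -> rat_formula h ->
  rat_formula (qe_rcf.If f g h).
Proof. by []. Qed.

(** The elimination procedure is written in continuation-passing style. Hence the invariant of each
    of its routines: the output is rational as soon as the continuation [k] gives rational formulas
    on all rational arguments. *)
Lemma rat_Size p k : rat_poly p -> (forall n, rat_formula (k n)) ->
  rat_formula (qe_rcf.Size p k).
Proof.
elim: p k => [|c p IH] k //= /rat_polyW[hc hp] hk.
by apply: IH => // -[|n] //; apply: rat_If => //=.
Qed.

Lemma rat_Isnull p k : rat_poly p -> (forall b, rat_formula (k b)) ->
  rat_formula (qe_rcf.Isnull p k).
Proof. by move=> hp hk; apply: rat_Size. Qed.

Lemma rat_LtSize p q k : rat_poly p -> rat_poly q ->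
  (forall b, rat_formula (k b)) -> rat_formula (qe_rcf.LtSize p q k).
Proof. by move=> hp hq hk; apply: rat_Size => // n; apply: rat_Size. Qed.

Lemma rat_LeadCoef p k : rat_poly p ->
  (forall t, rat_term t -> rat_formula (k t)) ->
  rat_formula (qe_rcf.LeadCoef p k).
Proof.
elim: p k => [|c p IH] k /= => [_ hk|/rat_polyW[hc hp] hk].
  by apply: hk; apply: ratr_const0.
by apply: IH => // t ht; apply: rat_If; auto; split.
Qed.

Lemma rat_AmulXn t n : rat_term t -> rat_poly (qe_rcf.AmulXn t n).
Proof.
move=> ht; elim: n => [|n IH] /=; first exact: rat_poly_cons.
by apply: rat_poly_cons => //; apply: ratr_const0.
Qed.

Lemma rat_AddPoly p q : rat_poly p -> rat_poly q ->
  rat_poly (qe_rcf.AddPoly p q).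
Proof.
elim: p q => [|a p IH] [|b q] //= /rat_polyW[? ?] /rat_polyW[? ?].
by apply: rat_poly_cons => //; apply: IH.
Qed.

Lemma rat_ScalPoly t p : rat_term t -> rat_poly p ->
  rat_poly (qe_rcf.ScalPoly t p).
Proof.
move=> ht; elim: p => [|a p IH] //= /rat_polyW[? ?].
by apply: rat_poly_cons => //; apply: IH.
Qed.

Lemma rat_MulPoly p q : rat_poly p -> rat_poly q ->
  rat_poly (qe_rcf.MulPoly p q).
Proof.
elim: p => [|a p IH] //= /rat_polyW[? hp] hq.
apply: rat_AddPoly; first exact: rat_ScalPoly.
by apply: rat_poly_cons => //; apply: IH.
Qed.

Lemma rat_ExpPoly p n : rat_poly p -> rat_poly (qe_rcf.ExpPoly p n).
Proof.
move=> hp; case: n => [|n]; first exact: rat_poly_cons.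
rewrite /qe_rcf.ExpPoly iteropS; elim: n => [|n IH] //=.
exact: rat_MulPoly.
Qed.

Lemma rat_OppPoly p : rat_poly p -> rat_poly (qe_rcf.OppPoly p).
Proof. by apply: rat_ScalPoly; apply: ratr_constN ratr_const1. Qed.

Lemma rat_NatMulPoly n p : rat_poly p -> rat_poly (qe_rcf.NatMulPoly n p).
Proof. exact: rat_ScalPoly. Qed.

Lemma rat_Deriv p : rat_poly p -> rat_poly (qe_rcf.Deriv p).
Proof.
elim: p => [|a p IH] //= /rat_polyW[? hp].
by apply: rat_AddPoly => //; apply: rat_poly_cons => //; apply: IH.
Qed.

Lemma rat_Rediv_rec_loop q sq cq c qq r n k :
  rat_poly q -> rat_term cq -> rat_poly qq -> rat_poly r ->
  (forall c' qq' r', rat_poly qq' -> rat_poly r' ->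
     rat_formula (k (c', qq', r'))) ->
  rat_formula (qe_rcf.Rediv_rec_loop q sq cq c qq r n k).
Proof.
move=> hq hcq; elim: n c qq r k => [|n IH] c qq r k hqq hr hk /=;
  apply: rat_Size => // m; case: ifP => _; try exact: hk;
  apply: rat_LeadCoef => // lr hlr; [apply: hk|apply: IH => //];
  repeat first [apply: rat_AddPoly | apply: rat_OppPoly | apply: rat_MulPoly
    | apply: rat_AmulXn | apply: rat_poly_cons | by []].
Qed.

Lemma rat_Rediv p q k : rat_poly p -> rat_poly q ->
  (forall c qq r, rat_poly qq -> rat_poly r -> rat_formula (k (c, qq, r))) ->
  rat_formula (qe_rcf.Rediv p q k).
Proof.
have h0 : rat_poly [:: qe_rcf.Const 0].
  by apply: rat_poly_cons => //; apply: ratr_const0.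
move=> hp hq hk; apply: rat_Isnull => // -[]; first exact: hk.
apply: rat_Size => // n; apply: rat_Size => // m; apply: rat_LeadCoef => // t ht.
exact: rat_Rediv_rec_loop.
Qed.

Lemma rat_Rgcd_loop n p q k : rat_poly p -> rat_poly q ->
  (forall r, rat_poly r -> rat_formula (k r)) ->
  rat_formula (qe_rcf.Rgcd_loop n p q k).
Proof.
elim: n p q k => [|n IH] p q k hp hq hk /=; apply: rat_Rediv => // c qq r _ hr;
  apply: rat_Isnull => // -[]; try exact: hk.
exact: IH.
Qed.

Lemma rat_Rgcd p q k : rat_poly p -> rat_poly q ->
  (forall r, rat_poly r -> rat_formula (k r)) ->
  rat_formula (qe_rcf.Rgcd p q k).
Proof.
move=> hp hq hk; apply: rat_LtSize => // -[]; apply: rat_Isnull => // -[];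
  try exact: hk; by apply: rat_Size => // n; apply: rat_Rgcd_loop.
Qed.

Lemma rat_BigRgcd ps k : rat_polys ps ->
  (forall r, rat_poly r -> rat_formula (k r)) ->
  rat_formula (qe_rcf.BigRgcd ps k).
Proof.
elim: ps k => [|p ps IH] k /= => [_ hk|/rat_polysW[hp hps] hk].
  by apply: hk; apply: rat_poly_cons => //; apply: ratr_const0.
by apply: IH => // r hr; apply: rat_Rgcd.
Qed.

Lemma rat_Changes (s : seq (qe_rcf.term F)) k : rat_poly s ->
  (forall n, rat_formula (k n)) -> rat_formula (qe_rcf.Changes s k).
Proof.
elim: s k => [|a s IH] k //= /rat_polyW[ha hs] hk.
apply: IH => // v; apply: rat_If => //=; do 2?split => //.
by case: s hs => //= b s /rat_polyW[].
Qed.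

Lemma rat_SeqPInfty ps k : rat_polys ps ->
  (forall s, rat_poly s -> rat_formula (k s)) ->
  rat_formula (qe_rcf.SeqPInfty ps k).
Proof.
elim: ps k => [|p ps IH] k /= => [_ hk|/rat_polysW[hp hps] hk]; first exact: hk.
apply: rat_LeadCoef => // t ht; apply: IH => // s hs.
by apply: hk; apply: rat_poly_cons.
Qed.

Lemma rat_SeqMInfty ps k : rat_polys ps ->
  (forall s, rat_poly s -> rat_formula (k s)) ->
  rat_formula (qe_rcf.SeqMInfty ps k).
Proof.
elim: ps k => [|p ps IH] k /= => [_ hk|/rat_polysW[hp hps] hk]; first exact: hk.
apply: rat_LeadCoef => // t ht; apply: rat_Size => // n; apply: IH => // s hs.
apply: hk; apply: rat_poly_cons => //=; split=> //.
exact: ratr_constN ratr_const1.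
Qed.

Lemma rat_ChangesPoly ps k : rat_polys ps ->
  (forall n, rat_formula (k n)) -> rat_formula (qe_rcf.ChangesPoly ps k).
Proof.
move=> hps hk; apply: rat_SeqMInfty => // mps hm.
apply: rat_SeqPInfty => // pps hp.
by apply: rat_Changes => // vm; apply: rat_Changes.
Qed.

Lemma rat_NextMod p q k : rat_poly p -> rat_poly q ->
  (forall r, rat_poly r -> rat_formula (k r)) ->
  rat_formula (qe_rcf.NextMod p q k).
Proof.
move=> hp hq hk; apply: rat_LeadCoef => // t ht.
apply: rat_Rediv => // c ? ? _ _; apply: rat_Rediv => // ? ? r _ hr.
by apply: hk; apply: rat_ScalPoly.
Qed.

Lemma rat_ModsAux p q n k : rat_poly p -> rat_poly q ->
  (forall ps, rat_polys ps -> rat_formula (k ps)) ->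
  rat_formula (qe_rcf.ModsAux p q n k).
Proof.
elim: n p q k => [|n IH] p q k hp hq hk /=; first exact: hk.
apply: rat_Isnull => // -[]; first exact: hk.
apply: rat_NextMod => // r hr; apply: IH => // ps hps.
by apply: hk; apply: rat_polys_cons.
Qed.

Lemma rat_Mods p q k : rat_poly p -> rat_poly q ->
  (forall ps, rat_polys ps -> rat_formula (k ps)) ->
  rat_formula (qe_rcf.Mods p q k).
Proof.
by move=> hp hq hk; apply: rat_Size => // n; apply: rat_Size => // m; apply: rat_ModsAux.
Qed.

Lemma rat_polys_nth ps i : rat_polys ps -> rat_poly (nth [::] ps i).
Proof.
elim: ps i => [|p ps IH] [|i] //= /rat_polysW[hp hps] //.
exact: IH.
Qed.

Lemma rat_PolyComb ps (sc : seq int) : rat_polys ps ->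
  rat_poly (qe_rcf.PolyComb ps sc).
Proof.
move=> hps; rewrite /qe_rcf.PolyComb; elim: (iota _ _) => [|i s IH] /=.
  exact: rat_poly_cons.
by apply: rat_MulPoly => //; apply: rat_ExpPoly; apply: rat_polys_nth.
Qed.

Lemma rat_Pcq ps i : rat_polys ps -> rat_poly (qe_rcf.Pcq ps i).
Proof.
move=> hps; apply: rat_polys_nth; elim: (qe_rcf_th.sg_tab _) => //= sc s IH.
by apply: rat_polys_cons => //; apply: rat_PolyComb.
Qed.

Lemma rat_TaqsR p ps i k : rat_poly p -> rat_polys ps ->
  (forall t, rat_term t -> rat_formula (k t)) ->
  rat_formula (qe_rcf.TaqsR p ps i k).
Proof.
move=> hp hps hk; apply: rat_Mods => //.
  by apply: rat_MulPoly; [apply: rat_Deriv|apply: rat_Pcq].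
move=> qs hqs; apply: rat_ChangesPoly => // n; apply: hk.
exact: ratr_const_int.
Qed.

Lemma rat_BoundingPoly ps : rat_polys ps -> rat_poly (qe_rcf.BoundingPoly ps).
Proof.
move=> hps; apply: rat_Deriv; elim: ps hps => [|p ps IH] /= => [_|/rat_polysW[? ?]].
  exact: rat_poly_cons.
by apply: rat_MulPoly => //; apply: IH.
Qed.

(** These coefficients are entries of the inverse of an integer matrix, and inversion commutes with
    the embedding of Q into F. *)
Lemma ratr_const_coefs n i : ratr_const (qe_rcf_th.coefs F n i).
Proof.
rewrite /qe_rcf_th.coefs; set s := enum _.
elim: s i => [|j s IH] [|i]; do ?exact: ratr_const0; last exact: IH.
rewrite /= castmxE; set M := map_mx _ _.
have -> : M = map_mx (@ratr F) (map_mx (intmul 1) (qe_rcf_th.ctmat n)).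
  by apply/matrixP => a b; rewrite !mxE ratr_int.
by rewrite -map_invmx mxE; eexists.
Qed.

Lemma rat_Coefs n i : rat_term (qe_rcf.Coefs F n i).
Proof.
case: n => [|[|n]] /=; first exact: ratr_const_int (Posz _).
  case: i => [|[|[|i]]] /=; do ?exact: ratr_constV (ratr_const_int (Posz 2)).
    exact: ratr_const0.
  by rewrite nth_nil; apply: ratr_const0.
exact: ratr_const_coefs.
Qed.

Lemma rat_CcountWeak p ps k : rat_poly p -> rat_polys ps ->
  (forall t, rat_term t -> rat_formula (k t)) ->
  rat_formula (qe_rcf.CcountWeak p ps k).
Proof.
move=> hp hps; rewrite /qe_rcf.CcountWeak.
(* The sum is built in an accumulator that starts at 0; the induction needs an arbitrary rational
   start. *)
have: rat_term (qe_rcf.NatConst F 0) by [].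
move: (qe_rcf.NatConst F 0) => s.
elim: (3 ^ _)%N s k => [|i IH] s k hs hk /=; first exact: hk.
by apply: rat_TaqsR => // x hx; apply: IH => //=; do !split => //; apply: rat_Coefs.
Qed.

Lemma rat_CcountGt0 ps qs : rat_polys ps -> rat_polys qs ->
  rat_formula (qe_rcf.CcountGt0 ps qs).
Proof.
move=> hps hqs; apply: rat_BigRgcd => // r hr; apply: rat_Isnull => // -[] /=.
  apply: rat_CcountWeak => //; first exact: rat_BoundingPoly.
  move=> t ht /=; split; [|split] => //.
    elim: qs hqs => [|q s IH] //= /rat_polysW[hq hs]; split; last exact: IH.
    exact: rat_LeadCoef.
  elim: qs hqs => [|q s IH] //= /rat_polysW[hq hs]; split; last exact: IH.
  by apply: rat_Size => // n; apply: rat_LeadCoef.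
exact: rat_CcountWeak.
Qed.

Lemma rat_abstrX i t : rat_term t -> rat_poly (qe_rcf.abstrX i t).
Proof.
elim: t => /=.
- by move=> n _; case: ifP => _; do !apply: rat_poly_cons.
- by move=> c hc; apply: rat_poly_cons.
- by move=> n _; apply: rat_poly_cons.
- by move=> u IHu v IHv [/IHu ? /IHv ?]; apply: rat_AddPoly.
- by move=> u IHu /IHu; apply: rat_OppPoly.
- by move=> u IHu n /IHu; apply: rat_NatMulPoly.
- by move=> u IHu v IHv [/IHu ? /IHv ?]; apply: rat_MulPoly.
- by move=> u IHu n /IHu; apply: rat_ExpPoly.
Qed.

Lemma rterm_to_termK t : qe_rcf.to_rterm (qe_rcf.rterm_to_term t) = t.
Proof. by elim: t => //= [u -> v ->|u ->|u -> n|u -> v ->|u -> n]. Qed.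

Lemma rat_wproj i (s1 s2 : seq (qe_rcf.term F)) : rat_poly s1 -> rat_poly s2 ->
  rat_formula (qe_rcf.wproj i (map (@qe_rcf.rterm_to_term F) s1,
                               map (@qe_rcf.rterm_to_term F) s2)).
Proof.
have aux s : rat_poly s ->
    rat_polys (map (qe_rcf.abstrX i \o qe_rcf.to_rterm)
                   (map (@qe_rcf.rterm_to_term F) s)).
  elim: s => //= t s IH /rat_polyW[ht hs].
  apply: rat_polys_cons; last exact: IH.
  by rewrite rterm_to_termK; apply: rat_abstrX.
by move=> h1 h2; apply: rat_CcountGt0; apply: aux.
Qed.

(** The specification of [wproj] speaks of a disjunctive normal form with one clause; its folds over
    lists of literals are unfolded here into plain quantifiers. *)
Lemma wprojP i (s1 s2 : seq (qe_rcf.term F)) (e : seq F) :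
  reflect (exists a, (forall t, List.In t s1 -> qe_rcf.eval (set_nth 0 e i a) t = 0)
              /\ (forall t, List.In t s2 -> 0 < qe_rcf.eval (set_nth 0 e i a) t))
    (qe_rcf.qf_eval e (qe_rcf.wproj i (map (@qe_rcf.rterm_to_term F) s1,
                               map (@qe_rcf.rterm_to_term F) s2))).
Proof.
rewrite qe_rcf.qf_evalE; set bc := (_, _).
have rt s : all (@GRing.rterm F) (map (@qe_rcf.rterm_to_term F) s).
  by elim: s => //= t s ->; rewrite qe_rcf.rtermF.
have hbc : ordered_qelim.ord.dnf_rterm (ordered_qelim.ord.w_to_oclause bc).
  by rewrite /ordered_qelim.ord.dnf_rterm /= !rt.
apply: (equivP (qe_rcf.valid_QE_wproj i e hbc)) => /=.
have fold_lit (g : GRing.term F -> ordered_qelim.ord.formula F) (P : F -> Prop) e' :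
    (forall u, ordered_qelim.ord.holds e' (g u) <-> P (GRing.eval e' u)) ->
    forall s, ordered_qelim.ord.holds e' (foldr (fun u => ordered_qelim.ord.And (g u))
        (ordered_qelim.ord.Bool true) (map (@qe_rcf.rterm_to_term F) s)) <->
      forall t, List.In t s -> P (qe_rcf.eval e' t).
  move=> hg; elim=> [|t s IH] //=.
  rewrite hg IH -qe_rcf.evalE; split=> [[h1 h2] u [<-|/h2] //|h].
  by split=> [|u hu]; apply: h; [left|right].
split=> -[a].
  case=> // -[] /(fold_lit _ (fun c => c = 0)) h1 [_ []].
  move=> /(fold_lit _ (fun c => 0 < c)) h2 _; exists a; split.
    by apply: h1.
  by apply: h2.
case=> h1 h2; exists a; left; split; [|split=> //; split=> //].
  by apply/(fold_lit _ (fun c => c = 0)).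
by apply/(fold_lit _ (fun c => 0 < c)).
Qed.

End RationalFormulas.

(** * Semialgebraic sets over Q *)

Section Semialgebraic.
Variable R : realType.

Local Notation SA := (@semialgebraic_over_Q R _).

Lemma qpoly_evalD N (p q : mpoly N rat) (z : 'rV[R]_N) :
  qpoly_eval (p + q) z = qpoly_eval p z + qpoly_eval q z.
Proof. exact: raddfD. Qed.

Lemma qpoly_evalN N (p : mpoly N rat) (z : 'rV[R]_N) :
  qpoly_eval (- p) z = - qpoly_eval p z.
Proof. exact: raddfN. Qed.

Lemma qpoly_evalM N (p q : mpoly N rat) (z : 'rV[R]_N) :
  qpoly_eval (p * q) z = qpoly_eval p z * qpoly_eval q z.
Proof. exact: rmorphM. Qed.

Lemma qpoly_evalC N (c : rat) (z : 'rV[R]_N) :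
  qpoly_eval (mpolyC N c) z = ratr c.
Proof. exact: mmapC. Qed.

Lemma qpoly_evalX N (i : 'I_N) (z : 'rV[R]_N) :
  qpoly_eval (mpolyX rat (mnm1 i)) z = z 0 i.
Proof. by rewrite /qpoly_eval mmapX mmap1U. Qed.

(** Closure properties are stated for functions, so that the polynomials behind concrete conditions
    never have to be written down. *)
Definition polyfun N (g : 'rV[R]_N -> R) : Prop :=
  exists p, forall z, g z = qpoly_eval p z.

Lemma polyfun_qpoly N (p : mpoly N rat) : polyfun (@qpoly_eval R N p).
Proof. by exists p. Qed.

Lemma polyfunD N (g h : 'rV[R]_N -> R) :
  polyfun g -> polyfun h -> polyfun (fun z => g z + h z).
Proof. by move=> [p hp] [q hq]; exists (p + q) => z; rewrite qpoly_evalD hp hq. Qed.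

Lemma polyfunN N (g : 'rV[R]_N -> R) : polyfun g -> polyfun (fun z => - g z).
Proof. by move=> [p hp]; exists (- p) => z; rewrite qpoly_evalN hp. Qed.

Lemma polyfunB N (g h : 'rV[R]_N -> R) :
  polyfun g -> polyfun h -> polyfun (fun z => g z - h z).
Proof. by move=> hg hh; apply: polyfunD => //; apply: polyfunN. Qed.

Lemma polyfunM N (g h : 'rV[R]_N -> R) :
  polyfun g -> polyfun h -> polyfun (fun z => g z * h z).
Proof. by move=> [p hp] [q hq]; exists (p * q) => z; rewrite qpoly_evalM hp hq. Qed.

Lemma polyfun_ratr N (c : rat) : polyfun (fun=> ratr c : R) (N := N).
Proof. by exists (mpolyC N c) => z; rewrite qpoly_evalC. Qed.

Lemma polyfun_coord N (i : 'I_N) : polyfun (fun z : 'rV[R]_N => z 0 i).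
Proof. by exists (mpolyX rat (mnm1 i)) => z; rewrite qpoly_evalX. Qed.

Lemma polyfun_sum N (I : Type) (r : seq I) (g : I -> 'rV[R]_N -> R) :
  (forall i, polyfun (g i)) -> polyfun (fun z => \sum_(i <- r) g i z).
Proof.
move=> hg; elim: r => [|i r [p hp]].
  by exists 0 => z; rewrite big_nil /qpoly_eval raddf0.
have [q hq] := hg i.
by exists (q + p) => z; rewrite big_cons hq hp qpoly_evalD.
Qed.

Lemma polyfunX N (g : 'rV[R]_N -> R) n :
  polyfun g -> polyfun (fun z => g z ^+ n).
Proof.
move=> [p hp]; exists (p ^+ n) => z; rewrite hp.
by elim: n => [|n IH]; rewrite ?expr0 ?exprS ?qpoly_evalM ?IH // /qpoly_eval rmorph1.
Qed.

(** Substituting for each variable a polynomial that represents the corresponding coordinate of [f]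
    gives the composite. *)
Lemma polyfun_comp N M (p : mpoly M rat) (f : 'rV[R]_N -> 'rV[R]_M) :
  (forall i, polyfun (fun z => f z 0 i)) ->
  polyfun (fun z => qpoly_eval p (f z)).
Proof.
move=> /choice[q hq]; exists (mmap (@mpolyC N rat) q p) => z.
elim/mpolyind: p => [|c m p _ _ IH].
  by rewrite /qpoly_eval !raddf0.
rewrite !raddfD /= !qpoly_evalD IH; congr (_ + _).
rewrite -mul_mpolyC rmorphM /= qpoly_evalM [RHS]qpoly_evalM mmapC !qpoly_evalC.
congr (_ * _); rewrite mmapX /qpoly_eval mmapX /mmap1 rmorph_prod.
by apply: eq_bigr => i _; rewrite hq /qpoly_eval rmorphXn.
Qed.

Lemma SA_ext N (A B : set 'rV[R]_N) : SA A -> (forall z, A z <-> B z) -> SA B.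
Proof. by move=> hA hAB; have <- : A = B by apply/seteqP; split=> z /hAB. Qed.

Definition basic_set N (c : seq (mpoly N rat) * seq (mpoly N rat))
    (z : 'rV[R]_N) : Prop :=
  (forall p, p \in c.1 -> qpoly_eval p z = 0) /\
  (forall q, q \in c.2 -> 0 < qpoly_eval q z).

Lemma SA_basic N c : SA (@basic_set N c).
Proof.
exists [:: c]; apply/seteqP; split=> z /=; first by exists c; rewrite ?mem_head.
by case=> c'; rewrite inE => /eqP ->.
Qed.

Lemma SA_setU N (A B : set 'rV[R]_N) : SA A -> SA B -> SA (A `|` B).
Proof.
move=> [s ->] [t ->]; exists (s ++ t); apply/seteqP; split=> z /=.
  by move=> [[c hc h]|[c hc h]]; exists c; rewrite // mem_cat hc ?orbT.
by move=> [c]; rewrite mem_cat => /orP[] hc h; [left|right]; exists c.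
Qed.

Lemma SA_setI N (A B : set 'rV[R]_N) : SA A -> SA B -> SA (A `&` B).
Proof.
move=> [s ->] [t ->].
exists [seq (c.1 ++ d.1, c.2 ++ d.2) | c <- s, d <- t]; apply/seteqP; split=> z /=.
  move=> [[c hc [h1 h2]] [d hd [h3 h4]]]; exists (c.1 ++ d.1, c.2 ++ d.2).
    by apply/allpairsP; exists (c, d).
  by split=> p; rewrite mem_cat => /orP[]; auto.
move=> [e /allpairsP[[c d] /= [hc hd ->]] /= [h1 h2]].
by split; [exists c|exists d] => //; split=> p hp; (apply: h1 || apply: h2);
  rewrite mem_cat hp ?orbT.
Qed.

Lemma SA_set0 N : SA (set0 : set 'rV[R]_N).
Proof. by exists [::]; apply/seteqP; split=> z // [c]. Qed.

Lemma SA_setT N : SA (setT : set 'rV[R]_N).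
Proof. by apply: (SA_ext (SA_basic ([::], [::]))) => z; split. Qed.

Lemma SA_eq0 N (g : 'rV[R]_N -> R) : polyfun g -> SA [set z | g z = 0].
Proof.
move=> [p hp]; apply: (SA_ext (SA_basic ([:: p], [::]))) => z; rewrite /= hp.
split=> [[h _]|h]; first by apply: h; rewrite mem_head.
by split=> // q; rewrite inE => /eqP ->.
Qed.

Lemma SA_gt0 N (g : 'rV[R]_N -> R) : polyfun g -> SA [set z | 0 < g z].
Proof.
move=> [p hp]; apply: (SA_ext (SA_basic ([::], [:: p]))) => z; rewrite /= hp.
split=> [[_ h]|h]; first by apply: h; rewrite mem_head.
by split=> // q; rewrite inE => /eqP ->.
Qed.

Lemma SA_le0 N (g : 'rV[R]_N -> R) : polyfun g -> SA [set z | g z <= 0].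
Proof.
move=> hg; apply: (SA_ext (SA_setU (SA_eq0 hg) (SA_gt0 (polyfunN hg)))) => z /=.
rewrite oppr_gt0 le_eqVlt; split=> [[->|->]|/orP[/eqP|]]; rewrite ?eqxx ?orbT //;
  by [left|right].
Qed.

Lemma SA_neq0 N (g : 'rV[R]_N -> R) : polyfun g -> SA [set z | g z <> 0].
Proof.
move=> hg; apply: (SA_ext (SA_setU (SA_gt0 hg) (SA_gt0 (polyfunN hg)))) => z /=.
rewrite oppr_gt0; split=> [[] h e|/eqP]; try by move: h; rewrite e ltxx.
by rewrite neq_lt => /orP[]; [right|left].
Qed.

Lemma SA_bigU N (I : eqType) (r : seq I) (A : I -> set 'rV[R]_N) :
  (forall i, i \in r -> SA (A i)) -> SA [set z | exists2 i, i \in r & A i z].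
Proof.
elim: r => [|i r IH] h; first by apply: (SA_ext (@SA_set0 N)) => z; split=> // -[].
have hr : SA [set z | exists2 i, i \in r & A i z].
  by apply: IH => j hj; apply: h; rewrite inE hj orbT.
apply: (SA_ext (SA_setU (h i (mem_head _ _)) hr)) => z /=; split.
  by move=> [hi|[j hj Aj]]; [exists i|exists j]; rewrite ?inE ?eqxx ?hj ?orbT.
by move=> [j]; rewrite inE => /orP[/eqP ->|hj Aj]; [left|right; exists j].
Qed.

Lemma SA_bigI N (I : eqType) (r : seq I) (A : I -> set 'rV[R]_N) :
  (forall i, i \in r -> SA (A i)) -> SA [set z | forall i, i \in r -> A i z].
Proof.
elim: r => [|i r IH] h; first by apply: (SA_ext (@SA_setT N)) => z; split.
have hr : SA [set z | forall i, i \in r -> A i z].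
  by apply: IH => j hj; apply: h; rewrite inE hj orbT.
apply: (SA_ext (SA_setI (h i (mem_head _ _)) hr)) => z /=; split.
  by move=> [Ai Ar] j; rewrite inE => /orP[/eqP ->|/Ar].
by move=> H; split=> [|j hj]; apply: H; rewrite ?mem_head // inE hj orbT.
Qed.

(** By De Morgan: the complement of a basic set is a finite union of sets p != 0 and q <= 0. *)
Lemma SA_setC N (A : set 'rV[R]_N) : SA A -> SA (~` A).
Proof.
move=> [s ->].
have hc (c : seq (mpoly N rat) * seq (mpoly N rat)) : c \in s ->
    SA (~` @basic_set N c).
  move=> _.
  have h1 := @SA_bigU N _ c.1 (fun p => [set z | qpoly_eval p z <> 0])
               (fun p _ => SA_neq0 (polyfun_qpoly p)).
  have h2 := @SA_bigU N _ c.2 (fun p => [set z | qpoly_eval p z <= 0])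
               (fun p _ => SA_le0 (polyfun_qpoly p)).
  apply: (SA_ext (SA_setU h1 h2)) => z /=; split.
    by move=> [[p hp h]|[p hp h]] [k1 k2]; [exact: (h (k1 p hp))|
      have := k2 p hp; rewrite ltNge h].
  move=> h; apply: contrapT => /not_orP[k1 k2]; apply: h; split=> p hp.
    by apply: contrapT => h; apply: k1; exists p.
  by rewrite ltNge; apply/negP => h; apply: k2; exists p.
apply: (SA_ext (SA_bigI hc)) => z /=; split=> [h [c cs hz]|h c cs hz].
  exact: (h c cs).
by apply: h; exists c.
Qed.

Lemma SA_preimage N M (A : set 'rV[R]_M) (f : 'rV[R]_N -> 'rV[R]_M) :
  (forall i, polyfun (fun z => f z 0 i)) -> SA A -> SA (f @^-1` A).
Proof.
move=> hf [s ->]; apply: (SA_ext (A := [set z | exists2 c, c \in s &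
  basic_set c (f z)])) => //.
apply: SA_bigU => c _.
have h1 := @SA_bigI N _ c.1 (fun p => [set z | qpoly_eval p (f z) = 0])
             (fun p _ => SA_eq0 (polyfun_comp p hf)).
have h2 := @SA_bigI N _ c.2 (fun p => [set z | 0 < qpoly_eval p (f z)])
             (fun p _ => SA_gt0 (polyfun_comp p hf)).
by apply: (SA_ext (SA_setI h1 h2)) => z.
Qed.

(** The valuation for formulas in [N] variables: variable [i] reads coordinate [i], and variables
    from [N] on read the default 0. *)
Definition env N (z : 'rV[R]_N) : seq R := [seq z 0 i | i <- enum 'I_N].

Lemma nth_env N (z : 'rV[R]_N) (i : 'I_N) : (env z)`_i = z 0 i.
Proof. by rewrite (nth_map i) ?size_enum_ord // nth_ord_enum. Qed.

Lemma nth_env_default N (z : 'rV[R]_N) i : (N <= i)%N -> (env z)`_i = 0.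
Proof. by move=> h; rewrite nth_default // size_map size_enum_ord. Qed.

Lemma polyfun_eval N (t : qe_rcf.term R) : rat_term t ->
  polyfun (fun z : 'rV[R]_N => qe_rcf.eval (env z) t).
Proof.
have nat_polyfun n : polyfun (fun=> n%:R : R) (N := N).
  by have [p hp] := @polyfun_ratr N n%:R; exists p => z; rewrite -hp ratr_nat.
elim: t => /=.
- move=> i _; have [h|h] := ltnP i N.
    by have [p hp] := polyfun_coord (Ordinal h); exists p => z; rewrite -hp -nth_env.
  by have [p hp] := nat_polyfun 0%N; exists p => z; rewrite -hp nth_env_default.
- by move=> c [q ->]; apply: polyfun_ratr.
- by move=> n _.
- by move=> u IHu v IHv [/IHu ? /IHv ?]; apply: polyfunD.
- by move=> u IHu /IHu; apply: polyfunN.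
- move=> u IHu n /IHu hu.
  have [p hp] := polyfunM hu (nat_polyfun n).
  by exists p => z; rewrite -hp mulr_natr.
- by move=> u IHu v IHv [/IHu ? /IHv ?]; apply: polyfunM.
- by move=> u IHu n /IHu; apply: polyfunX.
Qed.

Lemma SA_formula N (f : qe_rcf.formula R) : rat_formula f ->
  SA [set z : 'rV[R]_N | qe_rcf.qf_eval (env z) f].
Proof.
elim: f => /=.
- by move=> [] _; [apply: (SA_ext (@SA_setT N))|apply: (SA_ext (@SA_set0 N))].
- move=> u v [/(@polyfun_eval N _) hu /(@polyfun_eval N _) hv].
  apply: (SA_ext (SA_eq0 (polyfunB hu hv))) => z /=.
  by rewrite (rwP eqP) subr_eq0.
- move=> u v [/(@polyfun_eval N _) hu /(@polyfun_eval N _) hv].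
  by apply: (SA_ext (SA_gt0 (polyfunB hv hu))) => z /=; rewrite subr_gt0.
- move=> u v [/(@polyfun_eval N _) hu /(@polyfun_eval N _) hv].
  by apply: (SA_ext (SA_le0 (polyfunB hu hv))) => z /=; rewrite subr_le0.
- move=> g IHg h IHh [/IHg hg /IHh hh].
  by apply: (SA_ext (SA_setI hg hh)) => // z /=; split=> /andP.
- move=> g IHg h IHh [/IHg hg /IHh hh].
  by apply: (SA_ext (SA_setU hg hh)) => // z /=; split=> /orP.
- move=> g IHg h IHh [/IHg hg /IHh hh].
  apply: (SA_ext (SA_setU (SA_setC hg) hh)) => // z /=; split.
    by move=> [/negP/negbTE ->|->] //; rewrite implybT.
  by case: (qe_rcf.qf_eval _ g) => /=; [right|left].
- by move=> g IHg /IHg hg; apply: (SA_ext (SA_setC hg)) => z /=; split=> /negP.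
Qed.

Lemma mpoly_term N (p : mpoly N rat) : exists t : qe_rcf.term R, rat_term t /\
  forall z : 'rV[R]_N, qe_rcf.eval (env z) t = qpoly_eval p z.
Proof.
elim/mpolyind: p => [|c m p _ _ [t [ht IH]]].
  by exists (qe_rcf.NatConst _ 0); split=> // z; rewrite /qpoly_eval raddf0.
have [u [hu eu]] : exists u : qe_rcf.term R, rat_term u /\
    forall z : 'rV[R]_N, qe_rcf.eval (env z) u =
      \prod_(i <- enum 'I_N) z 0 i ^+ m i.
  elim: (enum 'I_N) => [|i s [u [hu IHu]]].
    by exists (qe_rcf.NatConst _ 1); split=> // z; rewrite big_nil.
  exists (qe_rcf.Mul (qe_rcf.Exp (qe_rcf.Var _ i) (m i)) u); split=> // z.
  by rewrite /= IHu nth_env big_cons.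
exists (qe_rcf.Add (qe_rcf.Mul (qe_rcf.Const (ratr c)) u) t); split=> /=.
  by do !split => //; exists c.
move=> z; rewrite IH eu qpoly_evalD -mul_mpolyC qpoly_evalM qpoly_evalC.
by rewrite /qpoly_eval mmapX /mmap1 big_enum.
Qed.

(** [P] is meant to be vanishing, for the equations of a clause, or positivity, for its
    inequalities. *)
Lemma mpoly_terms N (s : seq (mpoly N rat)) (P : R -> Prop) :
  exists ts : seq (qe_rcf.term R), rat_poly ts /\
  forall z : 'rV[R]_N, (forall t, List.In t ts -> P (qe_rcf.eval (env z) t)) <->
    (forall p, p \in s -> P (qpoly_eval p z)).
Proof.
elim: s => [|p s [ts [hts IH]]]; first by exists [::]; split=> //; apply: rat_poly_nil.
have [t [ht et]] := mpoly_term p.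
exists (t :: ts); split=> [|z]; first exact: rat_poly_cons.
split=> [h q|h u /=].
  rewrite inE => /orP[/eqP ->|]; first by rewrite -et; apply: h; left.
  by move=> hq; apply: (iffLR (IH z)) hq => u hu; apply: h; right.
move=> [<-|]; first by rewrite et; apply: h; rewrite mem_head.
by move=> hu; apply: (iffRL (IH z)) hu => q hq; apply: h; rewrite inE hq orbT.
Qed.

Definition set_coord N (z : 'rV[R]_N) (i : 'I_N) (a : R) : 'rV[R]_N :=
  \row_j (if j == i then a else z 0 j).

Lemma env_set_coord N (z : 'rV[R]_N) (i : 'I_N) (a : R) :
  set_nth 0 (env z) i a = env (set_coord z i a).
Proof.
have sz (y : 'rV[R]_N) : size (env y) = N by rewrite size_map size_enum_ord.
have szs : size (set_nth 0 (env z) i a) = N.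
  by rewrite size_set_nth sz; apply/maxn_idPr.
apply: (@eq_from_nth _ 0) => [|j]; first by rewrite szs sz.
rewrite szs => hj; rewrite nth_set_nth /=.
rewrite (nth_env (set_coord z i a) (Ordinal hj)) mxE -val_eqE /=.
by case: eqP => // _; rewrite (nth_env z (Ordinal hj)).
Qed.

(** The quantifier distributes over the union of basic sets, and on each of them [wproj] eliminates
    it; since the constants stay rational, the result is again semialgebraic over Q. *)
Lemma SA_exists_coord N (i : 'I_N) (A : set 'rV[R]_N) : SA A ->
  SA [set z | exists a, A (set_coord z i a)].
Proof.
move=> [s ->].
apply: (SA_ext (A := [set z | exists2 c, c \in s &
    exists a, basic_set c (set_coord z i a)])); last first.
  by move=> z; split=> [[c hc [a h]]|[a [c hc h]]]; [exists a, c|exists c => //; exists a].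
apply: SA_bigU => c _.
have [s1 [h1 e1]] := mpoly_terms c.1 (fun x => x = 0).
have [s2 [h2 e2]] := mpoly_terms c.2 (fun x => 0 < x).
apply: (SA_ext (@SA_formula N _ (rat_wproj i h1 h2))) => z /=.
split=> [/wprojP[a]|[a ha]]; last apply/wprojP.
  by rewrite env_set_coord => -[k1 k2]; exists a; split; [apply/e1|apply/e2].
by exists a; rewrite env_set_coord; case: ha => k1 k2; split; [apply/e1|apply/e2].
Qed.

Lemma SA_exists_coords N (s : seq 'I_N) (A : set 'rV[R]_N) : SA A ->
  SA [set z | exists y : 'rV[R]_N, (forall j, j \notin s -> y 0 j = z 0 j) /\ A y].
Proof.
move=> hA; elim: s => [|i s IH].
  apply: (SA_ext hA) => z; split=> [h|[y [hy Ay]]]; first by exists z.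
  by have <- : y = z by apply/rowP => j; apply: hy.
apply: (SA_ext (SA_exists_coord i IH)) => z /=; split.
  move=> [a [y [hy Ay]]]; exists y; split=> // j; rewrite inE negb_or => /andP[ji js].
  by rewrite hy // mxE (negbTE ji).
move=> [y [hy Ay]]; exists (y 0 i), y; split=> // j js; rewrite mxE.
by case: eqP => [->|/eqP ji] //; rewrite hy // inE negb_or ji.
Qed.

(** Eliminating the last [M] coordinates inside R^(N+M) leaves a set that does not depend on them;
    it is then pulled back along z |-> (z, 0). *)
Lemma tarski_seidenberg N M (A : set 'rV[R]_(N + M)) : SA A ->
  SA [set z : 'rV[R]_N | exists y : 'rV[R]_M, A (row_mx z y)].
Proof.
move=> hA; pose s := [seq rshift N j | j <- enum 'I_M].
have hf i : polyfun (fun z : 'rV[R]_N => row_mx z (0 : 'rV[R]_M) 0 i).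
  case: (splitP i) => j hj.
    have -> : i = lshift M j by apply: val_inj.
    have [p hp] := polyfun_coord j; exists p => z.
    by rewrite row_mxEl hp.
  have -> : i = rshift N j by apply: val_inj.
  have [p hp] := @polyfun_ratr N 0; exists p => z.
  by rewrite row_mxEr mxE -hp raddf0.
apply: (SA_ext (SA_preimage hf (SA_exists_coords s hA))) => z /=; split.
  move=> [y [hy Ay]]; exists (rsubmx y); suff -> : z = lsubmx y by rewrite hsubmxK.
  apply/rowP => j; rewrite !mxE hy ?row_mxEl //.
  apply/mapP => -[k _ /(congr1 val) /= e].
  by have := ltn_ord j; rewrite e ltnNge leq_addr.
move=> [y Ay]; exists (row_mx z y); split=> // j.
case: (splitP j) => k hk.
  have -> : j = lshift M k by apply: val_inj.
  by rewrite !row_mxEl.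
have -> : j = rshift N k by apply: val_inj.
by rewrite map_f // mem_enum.
Qed.

Lemma SA_forall N M (A : set 'rV[R]_(N + M)) : SA A ->
  SA [set z : 'rV[R]_N | forall y : 'rV[R]_M, A (row_mx z y)].
Proof.
move=> hA; apply: (SA_ext (SA_setC (tarski_seidenberg (SA_setC hA)))) => z /=.
split=> [h y|h [y hy]]; last exact: hy (h y).
by apply: contrapT => hy; apply: h; exists y.
Qed.

End Semialgebraic.

(** * The exposing condition as a first-order formula over Q *)

Definition dotr (R : realType) (n : nat) (u v : 'rV[R]_n) : R :=
  \sum_i u 0 i * v 0 i.

(* The matrices [A] and [B] say, without mentioning subspaces, that the face of
   [L] exposed by [c] has dimension at most [k]: the condition [v = v A B] puts [v]
   in the row space of [B]. *)
Definition exposing (R : realType) (n k : nat) (L : set 'rV[R]_n)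
    (y c : 'rV[R]_n) (A : 'M[R]_(n, k)) (B : 'M[R]_(k, n)) : Prop :=
  forall v, L v -> dotr c (v - y) <= 0 /\
    (dotr c (v - y) = 0 -> v - y = (v - y) *m A *m B).

Section ExposingSemialgebraic.
Variable R : realType.

Definition polymx N a b (F : 'rV[R]_N -> 'M[R]_(a, b)) : Prop :=
  forall i j, polyfun (fun u => F u i j).

Lemma polyfun_ext N (g h : 'rV[R]_N -> R) : polyfun g -> g =1 h -> polyfun h.
Proof. by move=> [p hp] e; exists p => z; rewrite -e. Qed.

Lemma polymx_id N : polymx (@id 'rV[R]_N).
Proof. by move=> i j; apply: (polyfun_ext (polyfun_coord _ j)) => z; rewrite ord1. Qed.

Lemma polymx_lsubmx N a b c (F : 'rV[R]_N -> 'M[R]_(a, b + c)) :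
  polymx F -> polymx (fun u => lsubmx (F u)).
Proof. by move=> hF i j; apply: (polyfun_ext (hF i (lshift c j))) => z; rewrite mxE. Qed.

Lemma polymx_rsubmx N a b c (F : 'rV[R]_N -> 'M[R]_(a, b + c)) :
  polymx F -> polymx (fun u => rsubmx (F u)).
Proof. by move=> hF i j; apply: (polyfun_ext (hF i (rshift b j))) => z; rewrite mxE. Qed.

Lemma polymx_vec_mx N a b (F : 'rV[R]_N -> 'rV[R]_(a * b)) :
  polymx F -> polymx (fun u => vec_mx (F u)).
Proof.
by move=> hF i j; apply: (polyfun_ext (hF 0 (mxvec_index i j))) => z; rewrite mxE.
Qed.

Lemma polymxB N a b (F G : 'rV[R]_N -> 'M[R]_(a, b)) :
  polymx F -> polymx G -> polymx (fun u => F u - G u).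
Proof.
by move=> hF hG i j; apply: (polyfun_ext (polyfunB (hF i j) (hG i j))) => z; rewrite !mxE.
Qed.

Lemma polymx_mul N a b c (F : 'rV[R]_N -> 'M[R]_(a, b)) (G : 'rV[R]_N -> 'M[R]_(b, c)) :
  polymx F -> polymx G -> polymx (fun u => F u *m G u).
Proof.
move=> hF hG i j.
have h := @polyfun_sum R N _ (index_enum _) _ (fun l => polyfunM (hF i l) (hG l j)).
by apply: (polyfun_ext h) => z; rewrite mxE.
Qed.

Lemma polymx_linear N m n (pi : {linear 'rV[R]_m -> 'rV[R]_n})
    (F : 'rV[R]_N -> 'rV[R]_m) :
  linear_over_Q pi -> polymx F -> polymx (fun u => pi (F u)).
Proof.
move=> hpi hF i j.
have hc : polymx (fun=> lin1_mx pi : 'M[R]_(m, n)) (N := N).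
  by move=> a b; have [q e] := hpi a b; apply: (polyfun_ext (@polyfun_ratr R N q)) => z /=; rewrite e.
by apply: (polyfun_ext (polymx_mul hF hc i j)) => z; rewrite mul_rV_lin1.
Qed.

(** Points of the image are written as pi(w) with w in K, so the condition has the form: there are
    c, A, B such that for all w a combination of polynomial conditions holds. Two quantifier
    eliminations finish; the rational matrix of [pi] keeps the polynomials over Q. *)
Lemma SA_exposing m n k (K : set 'rV[R]_m) (pi : {linear 'rV[R]_m -> 'rV[R]_n}) :
  semialgebraic_over_Q K -> linear_over_Q pi ->
  semialgebraic_over_Q [set z | exists (c : 'rV[R]_n) (A : 'M[R]_(n, k))
    (B : 'M[R]_(k, n)), exposing (pi @` K) (pi z) c A B].
Proof.
move=> hK hpi.
(* The variables are laid out in one row vector as ((z, (c, (A, B))), w), with the matrices A and B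
   flattened. *)
pose pz (u : 'rV[R]_(m + (n + (n * k + k * n)) + m)) := lsubmx (lsubmx u).
pose pw (u : 'rV[R]_(m + (n + (n * k + k * n)) + m)) := rsubmx u.
pose pc (u : 'rV[R]_(m + (n + (n * k + k * n)) + m)) := lsubmx (rsubmx (lsubmx u)).
pose pA (u : 'rV[R]_(m + (n + (n * k + k * n)) + m)) : 'M[R]_(n, k) :=
  vec_mx (lsubmx (rsubmx (rsubmx (lsubmx u)))).
pose pB (u : 'rV[R]_(m + (n + (n * k + k * n)) + m)) : 'M[R]_(k, n) :=
  vec_mx (rsubmx (rsubmx (rsubmx (lsubmx u)))).
pose pv u := pi (pw u) - pi (pz u).
have hpw : polymx pw by apply: polymx_rsubmx; apply: polymx_id.
have hpv : polymx pv.
  apply: polymxB; apply: polymx_linear => //.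
  by do 2!apply: polymx_lsubmx; apply: polymx_id.
have hl : polymx (fun u : 'rV[R]_(m + (n + (n * k + k * n)) + m) => rsubmx (lsubmx u)).
  by apply: polymx_rsubmx; apply: polymx_lsubmx; apply: polymx_id.
have hpc : polymx pc by apply: polymx_lsubmx.
have hAB : polymx (fun u => pv u - pv u *m pA u *m pB u).
  apply: polymxB => //; apply: polymx_mul; last first.
    by apply: polymx_vec_mx; do 2!apply: polymx_rsubmx.
  apply: polymx_mul => //.
  by apply: polymx_vec_mx; apply: polymx_lsubmx; apply: polymx_rsubmx.
have hdot : polyfun (fun u => dotr (pc u) (pv u)).
  by apply: polyfun_sum => i; apply: polyfunM.
have h0 := @SA_bigI R _ _ (index_enum 'I_n)
  (fun j => [set u | (pv u - pv u *m pA u *m pB u) 0 j = 0])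
  (fun j _ => SA_eq0 (hAB 0 j)).
have hset := SA_forall (SA_setU (SA_setC (SA_preimage (fun i => hpw 0 i) hK))
  (SA_setI (SA_le0 hdot) (SA_setU (SA_neq0 hdot) h0))).
have h1 (z w : 'rV[R]_m) (y : 'rV[R]_(n + (n * k + k * n))) :
    [/\ pw (row_mx (row_mx z y) w) = w, pz (row_mx (row_mx z y) w) = z &
       pc (row_mx (row_mx z y) w) = lsubmx y] /\
       pA (row_mx (row_mx z y) w) = vec_mx (lsubmx (rsubmx y)) /\
       pB (row_mx (row_mx z y) w) = vec_mx (rsubmx (rsubmx y)).
  by rewrite /pw /pz /pc /pA /pB !(row_mxKl, row_mxKr).
apply: (SA_ext (tarski_seidenberg hset)) => z /=.
have body y w : let u := row_mx (row_mx z y) w in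
  (~ K (pw u) \/ dotr (pc u) (pv u) <= 0 /\ (dotr (pc u) (pv u) <> 0 \/
    forall j, j \in index_enum 'I_n -> (pv u - pv u *m pA u *m pB u) 0 j = 0)) <->
  (K w -> dotr (lsubmx y) (pi w - pi z) <= 0 /\
    (dotr (lsubmx y) (pi w - pi z) = 0 -> pi w - pi z = (pi w - pi z) *m
       vec_mx (lsubmx (rsubmx y)) *m vec_mx (rsubmx (rsubmx y)))).
  move=> u; rewrite /pv; have [[-> -> ->] [-> ->]] := h1 z w y.
  split.
    case=> [//|[h2 h3] _]; split=> // e; case: h3 => // h3.
    apply/eqP; rewrite -subr_eq0; apply/eqP/rowP => j.
    by rewrite h3 ?mem_index_enum // mxE.
  move=> h; have [/h[h2 h3]|] := pselect (K w); [right|by left].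
  split=> //; have [/h3 e|] := pselect (dotr (lsubmx y) (pi w - pi z) = 0); [right|by left].
  by move=> j _; rewrite {1}e subrr mxE.
split=> [[y hy]|[c [A [B h]]]].
  exists (lsubmx y), (vec_mx (lsubmx (rsubmx y))), (vec_mx (rsubmx (rsubmx y))).
  by move=> v [w Kw <-]; apply: (iffLR (body y w)) => //; apply: hy.
exists (row_mx c (row_mx (mxvec A) (mxvec B))) => w.
apply/body => Kw; rewrite row_mxKl !row_mxKr row_mxKl !mxvecK.
by apply: h; exists w.
Qed.

End ExposingSemialgebraic.

(** * Faces of convex sets *)

Section Convexity.
Variable R : realType.

(** The form of [convex_set] with bare real weights, linked to it by [convex_setP]. *)
Definition cvx n (K : set 'rV[R]_n) : Prop :=
  forall a b t, 0 <= t -> t <= 1 -> K a -> K b -> K ((1 - t) *: a + t *: b).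

Lemma convex_setP n (K : set 'rV[R]_n) : convex_set K <-> cvx K.
Proof.
split=> [h a b t t0 t1 Ka Kb|h a b l].
  have := h b a (Itv01 t0 t1) (mem_set Kb) (mem_set Ka).
  by rewrite inE /conv /= addrC.
move=> /set_mem Ka /set_mem Kb; apply/mem_set.
have hc : (1 - l%:num) *: b + l%:num *: a = l%:num *: a + (1 - l%:num) *: b.
  exact: addrC.
have l0 : 0 <= l%:num by [].
have l1 : l%:num <= 1 by [].
by have := h b a l%:num l0 l1 Kb Ka; rewrite hc.
Qed.

(** A subspace of largest dimension inside [S] exhausts [S]: adjoining another vector of [S] would
    give a larger one. *)
Lemma subspace_vspace n (S : set 'rV[R]_n) : S 0 ->
  (forall a u v, S u -> S v -> S (a *: u + v)) ->
  exists V : {vspace 'rV[R]_n}, forall v, v \in V <-> S v.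
Proof.
move=> S0 Slin.
pose P d := `[< exists2 V : {vspace 'rV[R]_n}, (forall v, v \in V -> S v) & \dim V = d >].
have exP : exists d, P d.
  exists 0%N; apply/asboolP; exists 0%VS; last exact: dimv0.
  by move=> v; rewrite memv0 => /eqP ->.
have bndP d : P d -> (d <= \dim {:'rV[R]_n})%N.
  by move=> /asboolP[V _ <-]; apply/dimvS/subvf.
case: (ex_maxnP exP bndP) => d /asboolP[V hV dV] dmax.
exists V => v; split=> [/hV//|Sv].
have: P (\dim (V + <[v]>)%VS).
  apply/asboolP; exists (V + <[v]>)%VS => // w /memv_addP[u uV [x /vlineP[a ->] ->]].
  by rewrite addrC; apply: Slin => //; apply: hV.
move=> /dmax; rewrite -dV => h.
have /eqP -> : V == (V + <[v]>)%VS by rewrite eqEdim addvSl h.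
by apply: (subvP (addvSr _ _)); apply: memv_line.
Qed.

(* For convex [K], the direction of the affine hull of the face of [z]. *)
Definition dirs n (K : set 'rV[R]_n) (z d : 'rV[R]_n) : Prop :=
  exists e, [/\ 0 < e, K (z + e *: d) & K (z - e *: d)].

Lemma cvx_shrink n (K : set 'rV[R]_n) z d e e' : cvx K -> K z ->
  K (z + e *: d) -> 0 <= e' -> e' <= e -> K (z + e' *: d).
Proof.
move=> cK Kz Ke e'0 e'e.
have [e0|e0] := eqVneq e 0.
  by have -> : e' = 0 by [lra]; rewrite scale0r addr0.
have e0' : 0 < e by rewrite lt_neqAle eq_sym e0; lra.
have -> : z + e' *: d = (1 - e' / e) *: z + (e' / e) *: (z + e *: d).
  by apply/rowP => i; rewrite !mxE; field.
apply: cK => //; first by rewrite divr_ge0 // ltW.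
by rewrite ler_pdivrMr // mul1r.
Qed.

Lemma dirs_mid n (K : set 'rV[R]_n) z d e1 e2 : cvx K -> K z -> 0 < e1 -> 0 < e2 ->
  K (z + e1 *: d) -> K (z - e2 *: d) -> dirs K z d.
Proof.
move=> cK Kz e10 e20 h1 h2; exists (Num.min e1 e2); split.
- by rewrite lt_min e10.
- by apply: cvx_shrink h1 _ _ => //; [rewrite le_min !ltW|rewrite ge_min lexx].
- rewrite -scalerN; rewrite -scalerN in h2.
  by apply: cvx_shrink h2 _ _ => //; [rewrite le_min !ltW|rewrite ge_min lexx orbT].
Qed.

Lemma dirs_bound n (K : set 'rV[R]_n) z d : cvx K -> K z -> dirs K z d ->
  exists2 e, 0 < e & forall a, `|a| <= e -> K (z + a *: d).
Proof.
move=> cK Kz [e [e0 h1 h2]]; exists e => // a; rewrite ler_norml => /andP[a1 a2].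
have [a0|a0] := leP 0 a; first exact: cvx_shrink h1 _ _.
rewrite -[a]opprK scaleNr -scalerN; rewrite -scalerN in h2.
by apply: cvx_shrink h2 _ _ => //; lra.
Qed.

(** Closure under combinations holds because z + (g/2)(a u + v) is the midpoint of z + g a u and z +
    g v. *)
Lemma dirs_vspace n (K : set 'rV[R]_n) z : cvx K -> K z ->
  exists V : {vspace 'rV[R]_n}, forall d, d \in V <-> dirs K z d.
Proof.
move=> cK Kz; apply: subspace_vspace.
  by exists 1; rewrite scaler0 addr0 subr0.
move=> a u v /(dirs_bound cK Kz)[e e0 hu] /(dirs_bound cK Kz)[f f0 hv].
(* This choice gives |g a| <= e and g <= f; adding 1 to |a| keeps the denominator positive when a =
   0. *)
pose g := Num.min (e / (1 + `|a|)) f.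
have a1 : 0 < 1 + `|a| by rewrite ltr_pwDl.
have g0 : 0 < g by rewrite lt_min divr_gt0.
have g1 : g * `|a| <= e.
  apply: (@le_trans _ _ (e / (1 + `|a|) * (1 + `|a|))).
    by apply: ler_pM; rewrite ?(ltW g0) ?lerDr // /g ge_min lexx.
  by rewrite mulfVK // gt_eqF.
have g2 : g <= f by rewrite ge_min lexx orbT.
exists (g / 2); split; first by rewrite divr_gt0.
  have -> : z + (g / 2) *: (a *: u + v) =
     (1 - 2^-1) *: (z + (g * a) *: u) + 2^-1 *: (z + g *: v).
    by apply/rowP => i; rewrite !mxE; field.
  apply: cK; do ?lra.
    by apply: hu; rewrite normrM (gtr0_norm g0).
  by apply: hv; rewrite (gtr0_norm g0).
have -> : z - (g / 2) *: (a *: u + v) =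
   (1 - 2^-1) *: (z + (- (g * a)) *: u) + 2^-1 *: (z + (- g) *: v).
  by apply/rowP => i; rewrite !mxE; field.
apply: cK; do ?lra.
  by apply: hu; rewrite normrN normrM (gtr0_norm g0).
by apply: hv; rewrite normrN (gtr0_norm g0).
Qed.

(** Induction on the number of directions: the displaced point is the midpoint of one moved along
    the first direction and one moved along the others, both with doubled coefficients, which is why
    the bound is halved. *)
Lemma dirs_family n (K : set 'rV[R]_n) z N (v : 'I_N -> 'rV[R]_n) :
  cvx K -> K z -> (forall i, dirs K z (v i)) ->
  exists2 e, 0 < e & forall a : 'I_N -> R, (forall i, `|a i| <= e) ->
    K (z + \sum_i a i *: v i).
Proof.
move=> cK Kz; elim: N v => [|N IH] v hv.
  by exists 1 => // a _; rewrite big_ord0 addr0.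
have [e e0 he] := IH _ (fun i => hv (lift ord0 i)).
have [f f0 hf] := dirs_bound cK Kz (hv ord0).
exists (Num.min e f / 2); first by rewrite divr_gt0 // lt_min e0.
move=> a ha; rewrite big_ord_recl.
set s := \sum_(i < N) _.
have -> : z + (a ord0 *: v ord0 + s) =
    (1 - 2^-1) *: (z + (2 * a ord0) *: v ord0) +
    2^-1 *: (z + \sum_(i < N) (2 * a (lift ord0 i)) *: v (lift ord0 i)).
  have -> : \sum_(i < N) (2 * a (lift ord0 i)) *: v (lift ord0 i) = 2 *: s.
    by rewrite scaler_sumr; apply: eq_bigr => i _; rewrite scalerA.
  by apply/rowP => i; rewrite !mxE; field.
have hm i : `|2 * a i| <= Num.min e f.
  by rewrite normrM ger0_norm // mulrC -ler_pdivlMr.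
apply: cK; do ?lra.
  by apply: hf; apply: le_trans (hm _) _; rewrite ge_min lexx orbT.
by apply: he => i; apply: le_trans (hm _) _; rewrite ge_min lexx.
Qed.

Lemma normr_coord n (v : 'rV[R]_n) i : `|v 0 i| <= `|v|.
Proof.
rewrite [leRHS]/Num.Def.normr /= mx_normrE; apply/bigmax_geP; right => /=.
by exists (0, i).
Qed.

Lemma normr_ltP n (v : 'rV[R]_n) e : 0 < e ->
  (forall i, `|v 0 i| < e) -> `|v| < e.
Proof.
move=> e0 h; rewrite [ltLHS]/Num.Def.normr /= mx_normrE; apply/bigmax_ltP; split=> //.
by move=> [i j] _; rewrite /= ord1.
Qed.

Lemma normr_leP n (v : 'rV[R]_n) e : 0 <= e ->
  (forall i, `|v 0 i| <= e) -> `|v| <= e.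
Proof.
move=> e0 h; rewrite [leLHS]/Num.Def.normr /= mx_normrE; apply/bigmax_leP; split=> //.
by move=> [i j] _; rewrite /= ord1.
Qed.

Lemma linear_bound n p (f : {linear 'rV[R]_n -> 'rV[R]_p}) :
  exists2 M, 0 < M & forall v, `|f v| <= M * `|v|.
Proof.
exists (1 + \sum_i `|f (delta_mx 0 i)|); first by rewrite ltr_pwDl // sumr_ge0.
move=> v; rewrite [v in f v]row_sum_delta linear_sum.
apply: le_trans (ler_norm_sum _ _ _) _.
rewrite mulrDl mul1r mulr_suml ler_wpDl // ler_sum // => i _.
by rewrite linearZ normrZ mulrC ler_wpM2l // normr_coord.
Qed.

Lemma linear_continuous_rV n p (f : {linear 'rV[R]_n -> 'rV[R]_p}) : continuous f.
Proof.
have [M M0 hM] := linear_bound f.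
apply/linear_bounded_continuous/linear_boundedP; near=> r => v.
by apply: le_trans (hM v) _; rewrite ler_wpM2r //; near: r; apply: nbhs_pinfty_ge.
Unshelve. all: by end_near.
Qed.

(** Scaling about [y] stays in [A], and a u + v is the midpoint of 2 a u and 2 v. *)
Lemma affine_subspace n (A : set 'rV[R]_n) y : affine_set A -> A y ->
  exists V : {vspace 'rV[R]_n}, forall v, v \in V <-> A (y + v).
Proof.
move=> hA Ay.
have hZ a v : A (y + v) -> A (y + a *: v).
  move=> h; have := hA _ _ a Ay h; congr A.
  by apply/rowP => i; rewrite !mxE; ring.
apply: subspace_vspace; first by rewrite addr0.
move=> a u v hu hv.
have := hA _ _ 2^-1 (hZ (2 * a) _ hu) (hZ 2 _ hv); congr A.
by apply/rowP => i; rewrite !mxE; field.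
Qed.

Lemma affine_vspace n y (V : {vspace 'rV[R]_n}) :
  affine_set [set y + v | v in [set v | v \in V]].
Proof.
move=> _ _ t [u uV <-] [v vV <-]; exists ((1 - t) *: u + t *: v).
  by rewrite /= memvD // memvZ.
by apply/rowP => i; rewrite !mxE; ring.
Qed.

Lemma affine_hull_affine n (S : set 'rV[R]_n) : affine_set (affine_hull S).
Proof. by move=> x y t hx hy A [hA SA]; apply: (hA); [exact: hx (conj hA SA)|exact: hy (conj hA SA)]. Qed.

Lemma affine_hull_sub n (S : set 'rV[R]_n) : S `<=` affine_hull S.
Proof. exact: sub_gen_smallest. Qed.

Lemma affine_hull_min n (S A : set 'rV[R]_n) : affine_set A -> S `<=` A ->
  affine_hull S `<=` A.
Proof. by move=> hA SA z; apply; split. Qed.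

Lemma dim_leI n (S : set 'rV[R]_n) y (W : {vspace 'rV[R]_n}) k :
  S y -> (forall z, S z -> z - y \in W) -> (\dim W <= k)%N -> dim_le S k.
Proof.
move=> Sy hW Wk.
have [V hV] := affine_subspace (@affine_hull_affine _ S) (affine_hull_sub Sy).
exists (\dim V).
  exists y, V; split=> //; apply/seteqP; split=> [z hz|_ [v /hV hv <-] //].
  by exists (z - y); [apply/hV; rewrite addrC subrK|rewrite addrC subrK].
apply: leq_trans Wk; apply: dimvS; apply/subvP => v /hV.
move=> /(affine_hull_min (@affine_vspace _ y W)) [|w /= wW /addrI <-] //.
by move=> z /hW hz; exists (z - y) => //; rewrite addrC subrK.
Qed.

(** Coordinates in a basis are linear, hence bounded. This turns a norm neighbourhood, as in
    [relative_interior], into the bounds on coefficients that [dirs_family] asks for. *)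
Lemma near_coords n (V : {vspace 'rV[R]_n}) e : 0 < e ->
  exists2 d, 0 < d & forall v, v \in V -> `|v| < d ->
    forall i, `|coord (vbasis V) i v| <= e.
Proof.
move=> e0; pose f v := \row_i coord (vbasis V) i v.
have flin : linear f by move=> a u v; apply/rowP => i; rewrite !mxE linearP.
pose fL := GRing.isLinear.Build _ _ _ _ f flin.
pose g : {linear 'rV[R]_n -> 'rV[R]_(\dim V)} := HB.pack f fL.
have [M M0 hM] := linear_bound g.
exists (e / M); first by rewrite divr_gt0.
move=> v vV hv i; have -> : coord (vbasis V) i v = g v 0 i by rewrite mxE.
apply: le_trans (normr_coord _ _) _; apply: le_trans (hM v) _.
by rewrite mulrC -ler_pdivlMr // ltW.
Qed.

(** That z is a relative interior point of F follows from [dirs_family] for a basis of V. F is the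
    largest such set: if z is in the relative interior of C, then C extends a little beyond z, away
    from any of its points a, so a - z is a direction. *)
Lemma dirs_face n (K : set 'rV[R]_n) z (V : {vspace 'rV[R]_n}) :
  cvx K -> K z -> (forall d, d \in V <-> dirs K z d) ->
  let F := [set y | K y /\ y - z \in V] in
  affine_hull F = [set z + v | v in [set v | v \in V]] /\ is_face_at K z F.
Proof.
move=> cK Kz hV F.
have Fz : F z by split=> //; rewrite subrr mem0v.
have hF : affine_hull F = [set z + v | v in [set v | v \in V]].
  apply/seteqP; split.
    apply: affine_hull_min; first exact: affine_vspace.
    by move=> y [_ yV]; exists (y - z) => //; rewrite addrC subrK.
  move=> _ [v vV <-]; have [e [e0 h _]] := (hV v).1 vV.
  have Fe : F (z + e *: v) by split=> //; rewrite addrC addKr memvZ.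
  have := affine_hull_affine e^-1 (affine_hull_sub Fz) (affine_hull_sub Fe).
  congr (affine_hull F); apply/rowP => i; rewrite !mxE; field.
  by rewrite gt_eqF.
split=> //; split.
  split.
  - apply/convex_setP => a b t t0 t1 [Ka aV] [Kb bV]; split; first exact: cK.
    have -> : (1 - t) *: a + t *: b - z = (1 - t) *: (a - z) + t *: (b - z).
      by apply/rowP => i; rewrite !mxE; ring.
    by rewrite memvD // memvZ.
  - by move=> y [].
  - split=> //; rewrite hF.
    have hb i : dirs K z (vbasis V)`_i.
      have [hi|hi] := leqP (size (vbasis V)) i; apply/hV.
        by rewrite nth_default ?mem0v.
      by apply: vbasis_mem; rewrite mem_nth.
    have [e e0 he] := dirs_family cK Kz (fun i : 'I_(\dim V) => hb i).
    have [d d0 hd] := near_coords V e0.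
    apply/nbhs_ballP; exists d => // y; rewrite -ball_normE /= => zy [v vV vy].
    rewrite -vy in zy *; split; last by rewrite addrC addKr.
    rewrite (coord_vbasis vV); apply: he => i; apply: hd => //.
    by move: zy; rewrite opprD addNKr normrN.
move=> C [/convex_setP cC CK [Cz nC]] a Ca; split; first exact: CK.
have [e /= e0 he] := (nbhs_ballP _ _).1 nC.
(* Small enough that the step of length f |a - z| beyond z is at most e / 2. *)
pose f := e / (2 * (1 + `|a - z|)).
have a1 : 0 < 1 + `|a - z| by rewrite ltr_pwDl.
have f0 : 0 < f by rewrite divr_gt0 // mulr_gt0.
apply/hV; apply: (@dirs_mid _ _ _ _ 1 f cK Kz ltr01 f0).
  by rewrite scale1r addrC subrK; apply: CK.
apply: CK; apply: he.
  rewrite -ball_normE /= opprB addrC subrK normrZ (gtr0_norm f0).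
  apply: (@le_lt_trans _ _ (f * (1 + `|a - z|))).
    by rewrite ler_wpM2l ?(ltW f0) // lerDr.
  have -> : f * (1 + `|a - z|) = e / 2 by rewrite /f; field; rewrite gt_eqF.
  lra.
have := affine_hull_affine (- f) (affine_hull_sub Cz) (affine_hull_sub Ca).
by congr affine_hull; apply/rowP => i; rewrite !mxE; ring.
Qed.

(** Largest convex parts are unique, so the given face is the one built from [dirs]. Its affine hull
    is z + V, and comparing this with the given description x0 + W puts V inside W. *)
Lemma extreme_pointsP n k (K : set 'rV[R]_n) z : cvx K ->
  extreme_points k K z <-> K z /\ exists2 V : {vspace 'rV[R]_n},
    forall d, d \in V <-> dirs K z d & (\dim V <= k)%N.
Proof.
move=> cK; split=> -[Kz]; last first.
  move=> [V hV Vk]; split=> //.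
  have [hF hf] := dirs_face cK Kz hV.
  by eexists; [exact: hf|exists (\dim V) => //; exists z, V].
move=> [F hF [d [x0 [W [hW Wd]]] dk]]; split=> //.
have [V hV] := dirs_vspace cK Kz; exists V => //.
have [hG hg] := dirs_face cK Kz hV.
set G := [set y | _] in hG hg.
have FG : F = G.
  by apply/seteqP; split; [apply: hg.2 hF.1|apply: hF.2 hg.1].
rewrite FG hG in hW.
apply: leq_trans dk; rewrite -Wd; apply: dimvS; apply/subvP => v vV.
have [w0 w0W e0] : [set x0 + v | v in [set v | v \in W]] z.
  by rewrite -hW; exists 0; rewrite /= ?mem0v ?addr0.
have [w wW e] : [set x0 + v | v in [set v | v \in W]] (z + v).
  by rewrite -hW; exists v.
have -> : v = w - w0.
  by move: e; rewrite -e0 -addrA => /addrI ->; rewrite addrAC subrr add0r.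
exact: memvB.
Qed.

End Convexity.

(** * Separation *)

Section Continuity.
Variable R : realType.

Section TopologicalDomain.
Variable T : topologicalType.

Lemma contD (f g : T -> R) : continuous f -> continuous g ->
  continuous (fun z => f z + g z).
Proof. by move=> hf hg x; exact: cvgD (hf x) (hg x). Qed.

Lemma contN (f : T -> R) : continuous f -> continuous (fun z => - f z).
Proof. by move=> hf x; exact: cvgN (hf x). Qed.

Lemma contM (f g : T -> R) : continuous f -> continuous g ->
  continuous (fun z => f z * g z).
Proof. by move=> hf hg x; exact: cvgM (hf x) (hg x). Qed.

Lemma cont_cst (c : R) : continuous (fun _ : T => c).
Proof. by move=> x; exact: cvg_cst. Qed.

Lemma cont_sum (I : Type) (r : seq I) (P : pred I) (f : I -> T -> R) :
  (forall i, continuous (f i)) -> continuous (fun z => \sum_(i <- r | P i) f i z).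
Proof.
move=> hf; elim: r => [|i r IH].
  rewrite (_ : (fun z => _) = fun=> 0); first exact: cont_cst.
  by apply/funext => z; rewrite big_nil.
have [Pi|Pi] := boolP (P i); last first.
  rewrite (_ : (fun z => _) = fun z => \sum_(j <- r | P j) f j z) //.
  by apply/funext => z; rewrite big_cons (negbTE Pi).
rewrite (_ : (fun z => _) = fun z => f i z + \sum_(j <- r | P j) f j z).
  exact: contD.
by apply/funext => z; rewrite big_cons Pi.
Qed.

Lemma closed_ge_cont (f : T -> R) e : continuous f -> closed [set z | e <= f z].
Proof. by move=> /continuous_closedP/(_ _ (@closed_ge R e)). Qed.

End TopologicalDomain.

Lemma cont_coord n (p : 'rV[R]_n) i : continuous (fun z : 'rV[R]_n => (z - p) 0 i).
Proof.
rewrite (_ : (fun z => _) = fun z : 'rV[R]_n => z 0 i + (- p 0 i)).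
  by apply: contD; [exact: coord_continuous|exact: cont_cst].
by apply/funext => z; rewrite !mxE.
Qed.

Lemma cont_dotr n (c p : 'rV[R]_n) : continuous (fun z : 'rV[R]_n => dotr c (z - p)).
Proof.
by apply: cont_sum => i; apply: contM; [exact: cont_cst|exact: cont_coord].
Qed.

Lemma cont_sumsq n (J : pred 'I_n) (p : 'rV[R]_n) :
  continuous (fun z : 'rV[R]_n => \sum_(i | J i) (z - p) 0 i ^+ 2).
Proof.
by apply: cont_sum => i; apply: contM; exact: cont_coord.
Qed.

Lemma cont_dist n (p : 'rV[R]_n) : continuous (fun z : 'rV[R]_n => `|z - p| : R).
Proof.
move=> x; apply: (@cvg_norm _ _ _ (nbhs x) _ (fun z => z - p)).
by apply: cvgB; [exact: cvg_id|exact: cvg_cst].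
Qed.

Lemma max_on_compact n (D : set 'rV[R]_n) (f : 'rV[R]_n -> R) :
  compact D -> continuous f -> D !=set0 ->
  exists2 d, D d & forall z, D z -> f z <= f d.
Proof.
move=> cD cf D0.
have [d /set_mem Dd hd] := EVT_max_rV D0 cD (continuous_subspaceT cf).
by exists d => // z Dz; apply: hd; rewrite inE.
Qed.

Lemma min_on_compact n (D : set 'rV[R]_n) (f : 'rV[R]_n -> R) :
  compact D -> continuous f -> D !=set0 ->
  exists2 d, D d & forall z, D z -> f d <= f z.
Proof.
move=> cD cf D0.
have [d Dd hd] := max_on_compact cD (contN cf) D0.
by exists d => // z Dz; rewrite -lerN2; apply: hd.
Qed.

Lemma compact_setI_ge n (D : set 'rV[R]_n) (f : 'rV[R]_n -> R) e :
  compact D -> continuous f -> compact (D `&` [set z | e <= f z]).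
Proof. by move=> cD cf; apply: compact_closedI => //; apply: closed_ge_cont. Qed.

End Continuity.

Section DotProduct.
Variables (R : realType) (n : nat).
Implicit Types (u v w : 'rV[R]_n).

Lemma dotrC u v : dotr u v = dotr v u.
Proof. by apply: eq_bigr => i _; rewrite mulrC. Qed.

Lemma dotrDr u v w : dotr u (v + w) = dotr u v + dotr u w.
Proof. by rewrite -big_split; apply: eq_bigr => i _; rewrite !mxE mulrDr. Qed.

Lemma dotrZr u v a : dotr u (a *: v) = a * dotr u v.
Proof. by rewrite mulr_sumr; apply: eq_bigr => i _; rewrite !mxE mulrCA. Qed.

Lemma dotrNr u v : dotr u (- v) = - dotr u v.
Proof. by rewrite -scaleN1r dotrZr mulN1r. Qed.

Lemma dotrBr u v w : dotr u (v - w) = dotr u v - dotr u w.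
Proof. by rewrite dotrDr dotrNr. Qed.

Lemma dotr0 u : dotr u 0 = 0.
Proof. by rewrite -(scale0r 0) dotrZr mul0r. Qed.

Lemma dotrDl u v w : dotr (u + v) w = dotr u w + dotr v w.
Proof. by rewrite dotrC dotrDr !(dotrC w). Qed.

Lemma dotrZl u v a : dotr (a *: u) v = a * dotr u v.
Proof. by rewrite dotrC dotrZr dotrC. Qed.

Lemma dotrNl u v : dotr (- u) v = - dotr u v.
Proof. by rewrite dotrC dotrNr dotrC. Qed.

Lemma dotrBl u v w : dotr (u - v) w = dotr u w - dotr v w.
Proof. by rewrite dotrDl dotrNl. Qed.

Lemma dotr_ge0 u : 0 <= dotr u u.
Proof. by apply: sumr_ge0 => i _; rewrite -expr2 sqr_ge0. Qed.

Lemma dotr_coord u i : u 0 i ^+ 2 <= dotr u u.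
Proof.
rewrite /dotr (bigD1 i) //= -expr2 lerDl.
by apply: sumr_ge0 => j _; rewrite -expr2 sqr_ge0.
Qed.

Lemma dotr_eq0 u : dotr u u = 0 -> u = 0.
Proof.
move=> h; apply/rowP => i; rewrite mxE; apply/eqP; rewrite -sqrf_eq0 eq_le sqr_ge0.
by rewrite -h dotr_coord.
Qed.

Lemma dotr_gt0 u : u != 0 -> 0 < dotr u u.
Proof.
by move=> u0; rewrite lt_neqAle dotr_ge0 andbT eq_sym; apply: contra u0 => /eqP/dotr_eq0 ->.
Qed.

Lemma dotr_le_norm u v : `|dotr u v| <= n%:R * (`|u| * `|v|).
Proof.
apply: le_trans (ler_norm_sum _ _ _) _.
apply: (@le_trans _ _ (\sum_(i < n) (`|u| * `|v|))).
  by apply: ler_sum => i _; rewrite normrM ler_pM // normr_coord.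
by rewrite sumr_const card_ord mulr_natl.
Qed.

End DotProduct.

(** * Separating hyperplanes, caps around extreme points, and penalized maximizers *)

Section Separation.
Variables (R : realType) (n : nat).
Implicit Types (D A C : set 'rV[R]_n) (p c z : 'rV[R]_n).

(** Divide by t and let t tend to 0. This extracts the optimality condition at an extremum of a
    quadratic function along a segment. *)
Lemma first_order (a b : R) :
  (forall t, 0 < t -> t <= 1 -> 0 <= t * a + t ^+ 2 * b) -> 0 <= a.
Proof.
move=> h; rewrite leNgt; apply/negP => a0.
(* If a < 0, this t gives t b <= - a / 2, so that a + t b < 0. *)
pose t := Num.min 1 (- a / (2 * (1 + `|b|))).
have b1 : 0 < 1 + `|b| by rewrite ltr_pwDl.
have t0 : 0 < t by rewrite lt_min ltr01 divr_gt0 ?oppr_gt0 // mulr_gt0.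
have t1 : t <= 1 by rewrite ge_min lexx.
have t2 : t * (2 * (1 + `|b|)) <= - a.
  by rewrite -ler_pdivlMr ?mulr_gt0 // ge_min lexx orbT.
have := h t t0 t1; rewrite expr2 -mulrA -mulrDr pmulr_rge0 //.
have : t * b <= t * (1 + `|b|).
  by rewrite ler_wpM2l ?ltW //; have := ler_norm b; lra.
lra.
Qed.

(** [c] is p - d for the point d of D nearest to p in the Euclidean norm. Optimality of d along the
    segment to z gives the weak inequality, and d != p makes it strict. *)
Lemma separation D p : compact D -> cvx D -> ~ D p ->
  exists c, forall z, D z -> dotr c (z - p) < 0.
Proof.
move=> cD vD Dp.
have [D0|D0] := pselect (D !=set0); last by exists 0 => z Dz; case: D0; exists z.
have cq : continuous (fun z : 'rV[R]_n => dotr (z - p) (z - p)).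
  by apply: cont_sum => i; apply: contM; exact: cont_coord.
have [d Dd hd] := min_on_compact cD cq D0.
exists (p - d) => z Dz.
have dp : 0 < dotr (d - p) (d - p).
  by apply: dotr_gt0; rewrite subr_eq0; apply/eqP => e; apply: Dp; rewrite -e.
have : 0 <= 2 * dotr (d - p) (z - d).
  apply: (@first_order _ (dotr (z - d) (z - d))) => t t0 t1.
  have := hd _ (vD _ _ t (ltW t0) t1 Dd Dz).
  have -> : (1 - t) *: d + t *: z - p = (d - p) + t *: (z - d).
    by apply/rowP => i; rewrite !mxE; ring.
  move: (d - p) (z - d) => P Q.
  rewrite !(dotrDl, dotrDr, dotrZl, dotrZr) (dotrC Q P).
  set X := dotr P P; set Y := dotr P Q; set Z := dotr Q Q; nra.
have -> : dotr (p - d) (z - p) = - dotr (d - p) (z - d) - dotr (d - p) (d - p).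
  have -> : p - d = - (d - p) by rewrite opprB.
  have -> : z - p = (z - d) + (d - p) by rewrite subrKA.
  by move: (d - p) (z - d) => P Q; rewrite dotrNl dotrDr; ring.
lra.
Qed.

Lemma cvx_comb2 A a b s t : cvx A -> A a -> A b -> 0 <= s -> 0 <= t ->
  exists2 c, A c & s *: a + t *: b = (s + t) *: c.
Proof.
move=> vA Aa Ab s0 t0.
have [st0|st0] := eqVneq (s + t) 0.
  exists a => //; have -> : s = 0 by lra.
  have -> : t = 0 by lra.
  by rewrite addr0 !scale0r addr0.
exists ((1 - t / (s + t)) *: a + (t / (s + t)) *: b).
  apply: vA => //; first by rewrite divr_ge0 // addr_ge0.
  by rewrite ler_pdivrMr ?mul1r ?lerDr // lt_neqAle eq_sym st0 addr_ge0.
by apply/rowP => i; rewrite !mxE; field.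
Qed.

(** The union of the segments that join [D1] to [D2] is a continuous image of a compact product, and
    it is convex because weighted points of the same convex set merge into one. *)
Lemma hull2 A D1 D2 : cvx A -> cvx D1 -> cvx D2 -> compact D1 -> compact D2 ->
  D1 `<=` A -> D2 `<=` A ->
  exists D, [/\ cvx D, compact D, D `<=` A & D1 `|` D2 `<=` D].
Proof.
move=> vA v1 v2 c1 c2 s1 s2.
(* With an empty [D1] there would be no joining segments, and [D2] would be missed. *)
have [D10|D10] := pselect (D1 !=set0); last first.
  by exists D2; split => // z [Dz|//]; case: D10; exists z.
have [D20|D20] := pselect (D2 !=set0); last first.
  by exists D1; split => // z [//|Dz]; case: D20; exists z.
pose f (q : R * ('rV[R]_n * 'rV[R]_n)) := (1 - q.1) *: q.2.1 + q.1 *: q.2.2.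
exists (f @` (`[0, 1] `*` (D1 `*` D2))); split.
- move=> _ _ t t0 t1 [[r [a b]] [/= r01 [/= Da Db]] <-] [[r' [a' b']] [/= r01' [/= Da' Db']] <-].
  move: r01 r01'; rewrite !in_itv /= => /andP[r0 r1] /andP[r0' r1'].
  have [a'' Da'' ea] := @cvx_comb2 _ a a' ((1 - t) * (1 - r)) (t * (1 - r')) v1 Da Da'
    ltac:(by rewrite mulr_ge0 ?subr_ge0) ltac:(by rewrite mulr_ge0 ?subr_ge0).
  have [b'' Db'' eb] := @cvx_comb2 _ b b' ((1 - t) * r) (t * r') v2 Db Db'
    ltac:(by rewrite mulr_ge0 ?subr_ge0) ltac:(by rewrite mulr_ge0 ?subr_ge0).
  exists ((1 - t) * r + t * r', (a'', b'')).
    split=> //=; rewrite in_itv /= addr_ge0 ?mulr_ge0 ?subr_ge0 //=.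
    nra.
  rewrite /f /=.
  have -> : 1 - ((1 - t) * r + t * r') = (1 - t) * (1 - r) + t * (1 - r') by ring.
  by rewrite -ea -eb; apply/rowP => i; rewrite !mxE; ring.
- apply: continuous_compact.
    apply: continuous_subspaceT => -[r [a b]].
    apply: cvgD; apply: cvgZ.
    + apply: cvgB; first exact: cvg_cst.
      exact: cvg_fst.
    + exact: (@cvg_comp _ _ _ snd fst _ _ _ cvg_snd cvg_fst).
    + exact: cvg_fst.
    + exact: (@cvg_comp _ _ _ snd snd _ _ _ cvg_snd cvg_snd).
  by apply: compact_setX; [exact: segment_compact|exact: compact_setX].
- move=> _ [[r [a b]] [/= + [/= Da Db]] <-]; rewrite in_itv /= => /andP[r0 r1].
  by apply: vA; auto.
- move=> z [Dz|Dz].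
    have [b Db] := D20; exists (0, (z, b)).
      by split=> //=; rewrite in_itv /= lexx ler01.
    by rewrite /f /= subr0 scale1r scale0r addr0.
  have [a Da] := D10; exists (1, (a, z)).
    by split=> //=; rewrite in_itv /= lexx ler01.
  by rewrite /f /= subrr scale1r scale0r add0r.
Qed.

(** As p is extreme, A without p is convex. The points of A at sup distance at least e from p are
    covered by 2n compact convex slabs, one for each coordinate and sign; a compact convex set
    containing them all still avoids p, and is separated from it. *)
Lemma extreme_cap A p e : compact A -> cvx A -> 0 < e ->
  (forall a b t, A a -> A b -> 0 < t -> t < 1 -> p = (1 - t) *: a + t *: b -> a = b) ->
  exists c, forall z, A z -> e <= `|z - p| -> dotr c (z - p) < 0.
Proof.
move=> cA vA e0 pext.
pose A' := A `\ p.
have vA' : cvx A'.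
  move=> a b t t0 t1 [Aa ap] [Ab bp]; split; first exact: vA.
  move=> /= e1.
  have [t00|t00] := eqVneq t 0.
    by apply: ap; rewrite /= -e1 t00 subr0 scale1r scale0r addr0.
  have [t11|t11] := eqVneq t 1.
    by apply: bp; rewrite /= -e1 t11 subrr scale1r scale0r add0r.
  have ab := pext a b t Aa Ab ltac:(by rewrite lt_neqAle eq_sym t00)
    ltac:(by rewrite lt_neqAle t11) (esym e1).
  by apply: ap; rewrite /= -e1 ab -scalerDl subrK scale1r.
pose piece (i : 'I_n) (s : R) := A `&` [set z | e <= s * (z - p) 0 i].
have hp i s : [/\ cvx (piece i s), compact (piece i s) & piece i s `<=` A'].
  split.
  - move=> a b t t0 t1 [Aa /= ha] [Ab /= hb]; split; first exact: vA.
    rewrite /=.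
    have -> : s * ((1 - t) *: a + t *: b - p) 0 i =
       (1 - t) * (s * (a - p) 0 i) + t * (s * (b - p) 0 i) by rewrite !mxE; ring.
    move: ha hb => /=; set x := s * _; set y := s * _; nra.
  - by apply: compact_setI_ge => //; apply: contM; [exact: cont_cst|exact: cont_coord].
  - move=> z [Az /= hz]; split=> // zp; move: hz.
    by rewrite zp subrr mxE mulr0 leNgt e0.
have [D [vD cD DA hD]] : exists D, [/\ cvx D, compact D, D `<=` A' &
    forall i, i \in enum 'I_n -> forall s, s \in [:: 1; -1] -> piece i s `<=` D].
  elim: (enum 'I_n) => [|i r [D [vD cD DA hD]]].
    by exists set0; split; [move=> a b t _ _ []|exact: compact0|move=> z []|].
  have [[v1 c1 s1] [v2 c2 s2]] := (hp i 1, hp i (-1)).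
  have [D1 [vD1 cD1 DA1 hD1]] := hull2 vA' v1 v2 c1 c2 s1 s2.
  have [D2 [vD2 cD2 DA2 hD2]] := hull2 vA' vD vD1 cD cD1 DA DA1.
  exists D2; split=> // j; rewrite inE => /orP[/eqP ->|jr] s hs z hz; apply: hD2.
    right; apply: hD1; move: hs hz; rewrite !inE => /orP[] /eqP ->; by [left|right].
  by left; apply: hD jr _ hs _ hz.
have [c hc] := separation cD vD (fun Dp => (DA _ Dp).2 erefl).
exists c => z Az hz; apply: hc.
have [i hi] : exists i, e <= `|(z - p) 0 i|.
  apply: contrapT => h; move: hz; rewrite leNgt => /negP; apply.
  by apply: normr_ltP => // i; rewrite ltNge; apply/negP => hi; apply: h; exists i.
have [h0|h0] := leP 0 ((z - p) 0 i).
  apply: (hD i _ 1); rewrite ?mem_enum ?inE ?eqxx //.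
  by split=> //=; rewrite mul1r -(ger0_norm h0).
apply: (hD i _ (-1)); rewrite ?mem_enum ?inE ?eqxx ?orbT //.
by split=> //=; rewrite mulN1r -(ltr0_norm h0).
Qed.

(* A large penalty on the coordinates in [J] forces every maximizer of
   [z |-> <b, z - p> - |(z - p)_J|^2 / 2] close to the slice given by [c]. *)
Lemma penalized_location C p c (J : {set 'I_n}) e : compact C ->
  (forall z, C z -> (forall i, i \in J -> (z - p) 0 i = 0) -> e <= `|z - p| ->
     dotr c (z - p) < 0) ->
  exists b0 r, 0 < r /\ forall b, `|b - b0| < r ->
    forall z, C z -> e <= `|z - p| ->
      dotr b (z - p) - 2^-1 * \sum_(i in J) (z - p) 0 i ^+ 2 < 0.
Proof.
move=> cC hc.
pose h z := \sum_(i in J) (z - p) 0 i ^+ 2 : R.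
have h_ge0 z : 0 <= h z by apply: sumr_ge0 => i _; apply: sqr_ge0.
have ch : continuous h by apply: cont_sumsq.
pose D := C `&` [set z | e <= `|z - p|].
have cD : compact D by apply: compact_setI_ge => //; apply: cont_dist.
have cdot := @cont_dotr R n c p.
(* Where <c, z - p> < 0 any M > 0 works. On the rest of [D], a compact set, [h] has a positive
   minimum and <c, z - p> is bounded above, so a large M works. *)
have [M M0 hM] : exists2 M, 0 < M & forall z, D z -> dotr c (z - p) - M * h z < 0.
  pose P := D `&` [set z | 0 <= dotr c (z - p)].
  have cP : compact P by apply: compact_setI_ge.
  have [P0|P0] := pselect (P !=set0); last first.
    exists 1 => // z Dz; have : dotr c (z - p) < 0.
      by rewrite ltNge; apply/negP => hz; apply: P0; exists z.
    by have := h_ge0 z; lra.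
  have [z1 Pz1 m1] := min_on_compact cP ch P0.
  have [[Cz1 /= ez1] /= dz1] := Pz1.
  have [z2 _ m2] := max_on_compact cP cdot P0.
  have h1 : 0 < h z1.
    rewrite lt_neqAle h_ge0 andbT; apply/eqP => e0.
    have : dotr c (z1 - p) < 0.
      apply: hc => // i iJ; apply/eqP; rewrite -sqrf_eq0 eq_le sqr_ge0 andbT.
      rewrite e0 /h (bigD1 i) //= lerDl; apply: sumr_ge0 => j _; exact: sqr_ge0.
    lra.
  have B0 : 0 <= dotr c (z2 - p) by apply: le_trans dz1 (m2 _ Pz1).
  exists ((dotr c (z2 - p) + 1) / h z1); first by rewrite divr_gt0 // ltr_wpDl.
  move=> z Dz; have [hz|hz] := leP 0 (dotr c (z - p)).
    have Pz : P z by [].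
    have : (dotr c (z2 - p) + 1) <= (dotr c (z2 - p) + 1) / h z1 * h z.
      rewrite -mulrA ler_peMr //; first lra.
      by rewrite mulrC ler_pdivlMr // mul1r m1.
    by have := m2 z Pz; lra.
  have : 0 <= (dotr c (z2 - p) + 1) / h z1 * h z.
    by rewrite mulr_ge0 // divr_ge0 // ?ltW // ltr_wpDl.
  lra.
(* Dividing by 2 M normalizes the penalty M h to h / 2. *)
pose b0 := (2 * M)^-1 *: c.
pose g z := dotr b0 (z - p) - 2^-1 * h z.
have cg : continuous g.
  by apply: contD; [exact: cont_dotr|apply: contN; apply: contM => //; exact: cont_cst].
have hg z : D z -> g z < 0.
  move=> /hM hz; rewrite /g /b0 dotrZl.
  have -> : (2 * M)^-1 * dotr c (z - p) - 2^-1 * h z =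
     (2 * M)^-1 * (dotr c (z - p) - M * h z) by field; rewrite gt_eqF.
  by rewrite pmulr_rlt0 // invr_gt0 mulr_gt0.
have [D0|D0] := pselect (D !=set0); last first.
  by exists 0, 1; split=> // b _ z Cz ez; case: D0; exists z.
have [z1 Dz1 m1] := max_on_compact cD cg D0.
have [z2 Dz2 m2] := max_on_compact cD (@cont_dist R n p) D0.
have g1 := hg _ Dz1.
have n1 : 0 < 1 + n%:R * `|z2 - p| by rewrite ltr_pwDl // mulr_ge0.
(* On [D], replacing [b0] by a [b] within this radius changes the inner product by less than the gap
   - g z1 between the maximum of [g] and 0. *)
exists b0, (- g z1 / (1 + n%:R * `|z2 - p|)); split.
  by rewrite divr_gt0 // oppr_gt0.
move=> b; rewrite ltr_pdivlMr // => hb z Cz ez.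
have Dz : D z by [].
have gz := m1 z Dz; have zz2 := m2 z Dz; rewrite -/(h z).
have gE : g z = dotr b0 (z - p) - 2^-1 * h z by [].
have -> : dotr b (z - p) = dotr (b - b0) (z - p) + dotr b0 (z - p).
  by rewrite dotrBl subrK.
have k1 := le_trans (ler_norm _) (dotr_le_norm (b - b0) (z - p)).
have k2 : n%:R * (`|b - b0| * `|z - p|) <= `|b - b0| * (1 + n%:R * `|z2 - p|).
  rewrite mulrCA ler_wpM2l //.
  have : n%:R * `|z - p| <= n%:R * `|z2 - p| by rewrite ler_wpM2l.
  lra.
lra.
Qed.

End Separation.

(** * Asplund's theorem *)

(** Puts the completeness of matrix spaces together with their norm, for the use of [Baire]. *)
HB.instance Definition _ (R : realType) m n := Complete.on 'M[R]_(m, n).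

Lemma choice_on (T T' : Type) (y0 : T') (X : T -> Prop) (P : T -> T' -> Prop) :
  (forall x, X x -> exists y, P x y) -> exists f, forall x, X x -> P x (f x).
Proof.
move=> h; have /choice[f hf] : forall x, exists y, X x -> P x y.
  move=> x; have [/h[y hy]|hx] := pselect (X x); first by exists y.
  by exists y0.
by exists f.
Qed.

Section Asplund.
Variables (R : realType) (n : nat).
Implicit Types (C S X : set 'rV[R]_n) (p y z c b : 'rV[R]_n) (I J : {set 'I_n}).

(** J is the set of pivots of a reduced echelon basis. One pivot i is split off at a time, passing
    to the subspace of U where coordinate i vanishes. *)
Lemma vspace_coords (U : {vspace 'rV[R]_n}) : exists J : {set 'I_n},
  [/\ #|J| = \dim U, forall u, u \in U -> (forall i, i \in J -> u 0 i = 0) -> u = 0 &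
    forall i, i \in J -> exists2 u, u \in U &
      u 0 i = 1 /\ forall j, j \in J -> j != i -> u 0 j = 0].
Proof.
move: {2}(\dim U) (erefl (\dim U)) => d; elim: d U => [|d IH] U dU.
  exists finset.set0; rewrite cards0 dU; split=> // [u uU _|i]; last by rewrite inE.
  have /eqP U0 : U == 0%VS by rewrite -dimv_eq0 dU.
  by move: uU; rewrite U0 memv0 => /eqP.
have U0 : vpick U != 0 by rewrite vpick0 -dimv_eq0 dU.
have [i hi] : exists i, vpick U 0 i != 0.
  apply: contrapT => h; case/negP: U0; apply/eqP/rowP => i; rewrite mxE.
  by apply/eqP; apply: contrapT => hi; apply: h; exists i; apply/negP.
have [u uU ui] : exists2 u, u \in U & u 0 i = 1.
  by exists ((vpick U 0 i)^-1 *: vpick U); rewrite ?memvZ ?memv_pick // mxE mulVf.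
pose f := linfun (col i : 'rV[R]_n -> 'M[R]_(1, 1)).
pose U' := (U :&: lker f)%VS.
have U'P v : v \in U' = (v \in U) && (v 0 i == 0).
  rewrite memv_cap memv_ker lfunE /=; congr (_ && _).
  apply/eqP/eqP => [/rowP/(_ 0)|h]; first by rewrite !mxE.
  by apply/rowP => j; rewrite !mxE.
have dU' : \dim U' = d.
  have dimf : (\dim (f @: U) = 1)%N.
    apply/eqP; rewrite eqn_leq; apply/andP; split.
      by apply: leq_trans (dimvS (subvf _)) _; rewrite dimvf /dim /= muln1.
    rewrite lt0n dimv_eq0; apply/negP => /eqP h.
    have : f u \in (f @: U)%VS by rewrite memv_img.
    rewrite h memv0 lfunE /= => /eqP/rowP/(_ 0); rewrite !mxE ui => /eqP.
    by rewrite oner_eq0.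
  by have := limg_ker_dim f U; rewrite -/U' dimf dU addn1 => -[].
have [J' [cJ injJ dualJ]] := IH U' dU'.
have iJ' : i \notin J'.
  apply/negP => /dualJ[v]; rewrite U'P => /andP[_ /eqP v0] [v1 _].
  by move: v1; rewrite v0 => /eqP; rewrite eq_sym oner_eq0.
have [|w hw] := @choice_on _ _ 0 (fun j => j \in J') (fun j v => [/\ v \in U',
    v 0 j = 1 & forall l, l \in J' -> l != j -> v 0 l = 0]).
  by move=> j /dualJ[v vU' [v1 v0]]; exists v.
exists (i |: J'); split.
- by rewrite cardsU1 iJ' cJ dU' dU.
- move=> v vU hv; apply: injJ; last by move=> j jJ; apply: hv; rewrite !inE jJ orbT.
  by rewrite U'P vU hv ?eqxx // !inE eqxx.
- move=> j; rewrite !inE => /orP[/eqP ->|jJ].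
    (* Clearing the coordinates of u in J' does not affect coordinate i, where every [w l]
       vanishes. *)
    exists (u - \sum_(l in J') u 0 l *: w l).
      rewrite memvB // memv_suml // => l /hw[].
      by rewrite U'P => /andP[lU _] _ _; rewrite memvZ.
    split=> [|l]; rewrite !mxE summxE.
      rewrite ui big1 ?subr0 // => l /hw[]; rewrite U'P => /andP[_ /eqP h] _ _.
      by rewrite mxE h mulr0.
    rewrite !inE => /orP[->//|lJ] _; rewrite (bigD1 l) //= mxE.
    have [_ -> _] := hw l lJ; rewrite mulr1 big1 ?addr0 ?subrr // => l' /andP[lJ' ll'].
    by rewrite mxE; have [_ _ ->] := hw l' lJ'; rewrite ?mulr0 // eq_sym.
  have [wU' w1 w0] := hw j jJ; exists (w j).
    by move: wU'; rewrite U'P => /andP[].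
  split=> // l; rewrite !inE => /orP[/eqP -> _|]; last exact: w0.
  by move: wU'; rewrite U'P => /andP[_ /eqP].
Qed.

(* A point whose face has maximal dimension will do. *)
Lemma relint_exists S y : cvx S -> S y -> exists z (V : {vspace 'rV[R]_n}),
  [/\ S z, forall d, d \in V <-> dirs S z d & forall a, S a -> a - z \in V].
Proof.
move=> vS Sy.
pose P d := `[< exists z (V : {vspace 'rV[R]_n}), [/\ S z,
  forall v, v \in V <-> dirs S z v & \dim V = d] >].
have exP : exists d, P d.
  have [V hV] := dirs_vspace vS Sy.
  by exists (\dim V); apply/asboolP; exists y, V.
have bndP d : P d -> (d <= \dim {:'rV[R]_n})%N.
  by move=> /asboolP[z [V [_ _ <-]]]; apply/dimvS/subvf.
case: (ex_maxnP exP bndP) => d /asboolP[z [V [Sz hV dV]]] dmax.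
exists z, V; split=> // a Sa.
(* Every direction at z is one at the midpoint m, with half the step, so by maximality both have the
   same directions; and a - z is one at m, since m + (a - z)/2 = a and m - (a - z)/2 = z. *)
pose m := (1 - 2^-1) *: z + 2^-1 *: a.
have Sm : S m by apply: vS => //; lra.
have [W hW] := dirs_vspace vS Sm.
have VW : (V <= W)%VS.
  apply/subvP => v /hV[e [e0 h1 h2]]; apply/hW; exists (e / 2).
  split; first by rewrite divr_gt0.
    have := vS _ _ 2^-1 ltac:(lra) ltac:(lra) h1 Sa; congr S.
    by apply/rowP => i; rewrite !mxE; field.
  have := vS _ _ 2^-1 ltac:(lra) ltac:(lra) h2 Sa; congr S.
  by apply/rowP => i; rewrite !mxE; field.
have /eqP -> : V == W.
  by rewrite eqEdim VW dV; apply: dmax; apply/asboolP; exists m, W.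
apply/hW; exists 2^-1; split; first lra.
  by rewrite (_ : _ + _ = a) //; apply/rowP => i; rewrite !mxE; field.
by rewrite (_ : _ - _ = z) //; apply/rowP => i; rewrite !mxE; field.
Qed.

(** Since S spans more than k dimensions, a relative interior point can be moved inside S so as to
    vary more than k coordinates independently. By density of Q, a small move makes these
    coordinates of z + c rational. *)
Lemma rational_hit S y c k : cvx S -> S y ->
  (forall W : {vspace 'rV[R]_n}, (forall z, S z -> z - y \in W) -> (k < \dim W)%N) ->
  exists I (q : 'rV[rat]_n) z, [/\ (k < #|I|)%N, S z &
    forall i, i \in I -> (z + c) 0 i = ratr (q 0 i)].
Proof.
move=> vS Sy hk.
have [z [V [Sz hV SV]]] := relint_exists vS Sy.
have [I [cI _ dualI]] := vspace_coords V.
have [v hv] : exists v : 'I_n -> 'rV[R]_n, forall i, v i \in V /\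
    (i \in I -> v i 0 i = 1 /\ forall j, j \in I -> j != i -> v i 0 j = 0) /\
    (i \notin I -> v i = 0).
  suff /choice[v hv] : forall i, exists v : 'rV[R]_n, v \in V /\
      (i \in I -> v 0 i = 1 /\ forall j, j \in I -> j != i -> v 0 j = 0) /\
      (i \notin I -> v = 0) by exists v.
  move=> i.
  have [/dualI[u uV hu]|iI] := boolP (i \in I).
    by exists u; split=> //; split.
  by exists 0; split; first exact: mem0v.
have [e e0 he] := dirs_family vS Sz (fun i => (hV (v i)).1 (hv i).1).
have [q hq] : exists q : 'I_n -> rat, forall i,
    `|ratr (q i) - (z + c) 0 i| <= e.
  suff /choice[q hq] : forall i, exists q : rat, `|ratr q - (z + c) 0 i| <= e.
    by exists q.
  move=> i; have : (z + c) 0 i < (z + c) 0 i + e by rewrite ltrDl.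
  move=> /rat_in_itvoo[q]; rewrite in_itv /= => /andP[q1 q2]; exists q.
  by rewrite ler_norml; apply/andP; split; lra.
exists I, (\row_i q i), (z + \sum_i (ratr (q i) - (z + c) 0 i) *: v i); split.
- rewrite cI; apply: hk => a Sa.
  have -> : a - y = (a - z) - (y - z).
    by rewrite opprB addrA subrK.
  by apply: memvB; apply: SV.
- exact: he.
- move=> i iI; rewrite !mxE summxE (bigD1 i) //= mxE.
  have [_ [/(_ iI)[-> _] _]] := hv i; rewrite mulr1 big1 => [|j ji].
    by rewrite !mxE addr0; ring.
  rewrite mxE; have [jI|jI] := boolP (j \in I).
    have [_ [/(_ jI)[_ h0] _]] := hv j; by rewrite h0 ?mulr0 // eq_sym.
  by have [_ [_ ->//]] := hv j; rewrite !mxE mulr0.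
Qed.

(* Compare the number of cells of the parameter space with the number of points
   of a fine grid. *)
Lemma nowhere_dense_code (T : finType) X (g : 'rV[R]_n -> T -> R) rho L :
  (#|T| < n)%N -> 0 < rho -> 0 < L ->
  (forall b t, X b -> `|g b t| <= rho) ->
  (forall b b' d, 0 < d -> X b -> X b' -> (forall t, `|g b t - g b' t| <= d) ->
     `|b - b'| <= L * d) ->
  forall b0 s, 0 < s -> ~ ball b0 s `<=` closure X.
Proof.
move=> Tn rho0 L0 hrho hL b0 s s0 hX.
(* Each parameter range is cut into pieces of width 2 rho / M. The bound on [c] makes points of one
   cell at most s / (2 N) apart. The choice of [N] gives N^n > ((c + 1) N)^(n - 1), so there are
   more grid points than cells. *)
pose c := Num.bound (8 * L * rho / s).
have cP : 8 * L * rho / s < c%:R.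
  by apply: archi_boundP; rewrite divr_ge0 ?mulr_ge0 // ltW.
have c0 : 0 < c%:R :> R.
  by apply: le_lt_trans cP; rewrite divr_ge0 ?mulr_ge0 // ltW.
pose N := ((c.+1 ^ n.-1).+1)%N; pose M := (c * N)%N.
have N0 : 0 < N%:R :> R by rewrite ltr0n.
have M0 : 0 < M%:R :> R by rewrite natrM mulr_gt0.
pose P (a : {ffun 'I_n -> 'I_N}) := b0 + \row_(i < n) ((a i : nat)%:R * s / N%:R) : 'rV[R]_n.
have hP a : closure X (P a).
  apply: hX; rewrite -ball_normE /= opprD addNKr normrN.
  apply: normr_ltP => // i; rewrite !mxE ger0_norm; last first.
    by rewrite !mulr_ge0 ?invr_ge0 // ltW.
  by rewrite ltr_pdivrMr // [ltRHS]mulrC ltr_pM2r // ltr_nat ltn_ord.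
have e0 : 0 < s / (4 * N%:R) by rewrite divr_gt0 // mulr_gt0.
(* The grid points lie only in the closure of X; they are replaced by points of X within a quarter
   of the grid spacing s / N, which leaves distances of more than half the spacing. *)
have [beta hbeta] : exists beta : {ffun 'I_n -> 'I_N} -> 'rV[R]_n, forall a,
    X (beta a) /\ `|P a - beta a| < s / (4 * N%:R).
  suff /choice[beta hbeta] : forall a, exists b, X b /\ `|P a - b| < s / (4 * N%:R).
    by exists beta.
  move=> a; have [b [Xb]] := hP a (ball (P a) (s / (4 * N%:R))) (nbhsx_ballx _ _ e0).
  by rewrite -ball_normE /=; exists b.
have sep a a' : a != a' -> s / (2 * N%:R) < `|beta a - beta a'|.
  move=> aa'; have [i hi] : exists i, a i != a' i.
    apply: contrapT => h; case/negP: aa'; apply/eqP/ffunP => i.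
    by apply/eqP; apply: contrapT => hi; apply: h; exists i; apply/negP.
  have PP : s / N%:R <= `|P a - P a'|.
    apply: le_trans (normr_coord _ i); rewrite !mxE.
    have -> : b0 0 i + (a i)%:R * s / N%:R - (b0 0 i + (a' i)%:R * s / N%:R) =
       ((a i)%:R - (a' i)%:R) * (s / N%:R) by ring.
    have sN : 0 < s / N%:R by rewrite divr_gt0.
    rewrite normrM (gtr0_norm sN) ler_peMl ?(ltW sN) //.
    have -> : (a i)%:R - (a' i)%:R = ((a i)%:Z - (a' i)%:Z)%:~R :> R by rewrite intrB.
    rewrite -intr_norm ler1z -gtz0_ge1 normr_gt0 subr_eq0 eqz_nat.
    exact: hi.
  have t1 : `|P a - P a'| <= `|P a - beta a| + `|beta a - beta a'| + `|P a' - beta a'|.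
    rewrite [`|P a' - _|]distrC.
    apply: le_trans (ler_distD (beta a') _ _) _; rewrite lerD2r.
    exact: ler_distD.
  have [_ h1] := hbeta a; have [_ h2] := hbeta a'.
  have -> : s / (2 * N%:R) = s / N%:R - s / (4 * N%:R) - s / (4 * N%:R).
    by field; rewrite gt_eqF.
  lra.
(* The range [-rho, rho] is rescaled to [0, M] and the integer part taken as cell number; the right
   end rho gives M itself, whence M + 1 values. *)
pose X01 a t := (g (beta a) t + rho) / (2 * rho) * M%:R.
have hx a t : 0 <= X01 a t <= M%:R.
  have := hrho _ t (hbeta a).1; rewrite ler_norml => /andP[g1 g2].
  apply/andP; split.
    apply: mulr_ge0; last exact: ltW.
    by apply: divr_ge0; [lra|apply: ltW; apply: mulr_gt0].
  rewrite ler_piMl ?(ltW M0) // ler_pdivrMr ?mul1r ?mulr_gt0 //; lra.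
pose f a : {ffun T -> 'I_M.+1} := [ffun t => inord (Num.truncn (X01 a t))].
have finj : injective f.
  move=> a a' faa'; apply/eqP; apply: contrapT => /negP/sep.
  apply/negP; rewrite -leNgt.
  have d0 : 0 < 2 * rho / M%:R by rewrite divr_gt0 // mulr_gt0.
  apply: le_trans (hL _ _ _ d0 (hbeta a).1 (hbeta a').1 _) _.
    move=> t; have tE : Num.truncn (X01 a t) = Num.truncn (X01 a' t).
      have hM a2 : (Num.truncn (X01 a2 t) < M.+1)%N.
        have /andP[h1 h2] := hx a2 t.
        rewrite ltnS -(ler_nat R); apply: le_trans h2.
        by have /andP[] := truncn_itv h1.
      move/ffunP/(_ t): faa'; rewrite !ffunE => /(congr1 val) /=.
      by rewrite !inordK.
    have /andP[h1 _] := hx a t; have /andP[h1' _] := hx a' t.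
    have /andP[k1 k2] := truncn_itv h1; have /andP[k1' k2'] := truncn_itv h1'.
    rewrite tE in k1 k2.
    have -> : g (beta a) t - g (beta a') t = (X01 a t - X01 a' t) * (2 * rho / M%:R).
      by rewrite /X01; field; rewrite !gt_eqF.
    rewrite normrM (gtr0_norm d0) ler_piMl ?(ltW d0) // ler_norml.
    move: k2 k2'; rewrite -natr1 => k2 k2'.
    by apply/andP; split; lra.
  rewrite /M natrM ler_pdivlMr ?mulr_gt0 //.
  have -> : L * (2 * rho / (c%:R * N%:R)) * (2 * N%:R) = (4 * L * rho) / c%:R.
    by field; rewrite !gt_eqF.
  rewrite ler_pdivrMr //; move: cP; rewrite ltr_pdivrMr // mulrC => cP.
  have : 0 < L * rho by rewrite mulr_gt0.
  lra.
have := leq_card f finj; rewrite !card_ffun !card_ord.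
have Tn' : (#|T| <= n.-1)%N by rewrite -ltnS prednK //; apply: leq_ltn_trans Tn.
apply/negP; rewrite -ltnNge.
apply: (@leq_ltn_trans ((c.+1 * N) ^ n.-1)%N).
  apply: (@leq_trans ((c.+1 * N) ^ #|T|)%N).
    have exp_le (i1 i2 l : nat) : (i1 <= i2)%N -> (i1 ^ l <= i2 ^ l)%N.
      by move=> h; elim: l => // l IH; rewrite !expnS leq_mul.
    by apply: exp_le; rewrite mulSn -addn1 addnC leq_add2r.
  by rewrite leq_pexp2l // muln_gt0.
have n0 : (0 < n)%N by apply: leq_ltn_trans Tn.
by rewrite -{2}(prednK n0) expnS expnMn ltn_pmul2r ?expn_gt0.
Qed.

Definition coord_proj J (v : 'rV[R]_n) : 'rV[R]_n :=
  \row_i (if i \in J then v 0 i else 0).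

Lemma dotr_coord_proj J u v : dotr (coord_proj J u) v = \sum_(i in J) u 0 i * v 0 i.
Proof.
rewrite [RHS]big_mkcond; apply: eq_bigr => i _; rewrite mxE.
by case: ifP => // _; rewrite mul0r.
Qed.

(* The normal cone is monotone, so [c] is a 1-Lipschitz function of [z + c]. *)
Lemma bad_nowhere_dense C p b0 r I J (q : 'rV[rat]_n) : compact C -> 0 < r ->
  (#|J| < #|I|)%N ->
  let X := [set b | `|b - b0| < r /\ exists y z c, [/\ C y, C z,
     forall w, C w -> dotr c (w - z) <= 0, b = c + coord_proj J (y - p) &
     forall i, i \in I -> (z + c) 0 i = ratr (q 0 i)]] in
  forall b s, 0 < s -> ~ ball b s `<=` closure X.
Proof.
move=> cC r0 JI X.
have [ya [za [ca hX]]] : exists ya za ca : 'rV[R]_n -> 'rV[R]_n, forall b, X b ->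
   [/\ C (ya b), C (za b), forall w, C w -> dotr (ca b) (w - za b) <= 0,
     b = ca b + coord_proj J (ya b - p) &
     forall i, i \in I -> (za b + ca b) 0 i = ratr (q 0 i)].
  pose Q b (t : 'rV[R]_n * 'rV[R]_n * 'rV[R]_n) :=
    [/\ C t.1.1, C t.1.2, forall w, C w -> dotr t.2 (w - t.1.2) <= 0,
       b = t.2 + coord_proj J (t.1.1 - p) &
       forall i, i \in I -> (t.1.2 + t.2) 0 i = ratr (q 0 i)].
  have [|h hh] := @choice_on _ _ (0, 0, 0) X Q.
    by move=> b [_ [y [z [c hb]]]]; exists (y, z, c).
  by exists (fun b => (h b).1.1), (fun b => (h b).1.2), (fun b => (h b).2).
have [rho0 [rho00 hrho0]] : exists rho0, 0 <= rho0 /\ forall z, C z -> `|z| <= rho0.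
  have [M [_ hM]] := compact_bounded cC.
  exists (Num.max 0 (M + 1)); split=> [|z Cz]; first by rewrite le_max lexx.
  by rewrite le_max (hM (M + 1)) ?orbT // ltrDl.
(* The parameters are the coordinates of z + c outside I and those of y in J: n - |I| + |J| of them,
   fewer than n. The coordinates of z + c in I are fixed by [q]. *)
pose T : finType := ({i : 'I_n | i \notin I} + {j : 'I_n | j \in J})%type.
pose g b (t : T) : R := match t with inl i => (za b + ca b) 0 (val i)
                        | inr j => ya b 0 (val j) end.
have hcp u : `|coord_proj J u| <= `|u|.
  by apply: normr_leP => // i; rewrite mxE; case: ifP => _; rewrite ?normr0 // normr_coord.
(* The bound adds up estimates of |z| and of c = b - (y - p)_J. In the Lipschitz constant, n
   accounts for c and 1 for the coordinates of y. *)
apply: (@nowhere_dense_code T X g (`|b0| + r + `|p| + 2 * rho0) (n%:R + 1)).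
- rewrite card_sum !card_sig.
  have -> : #|[pred i | i \notin I]| = (n - #|I|)%N.
    have cI : (#|I| + #|[pred i | i \notin I]| = n)%N.
      by rewrite -[RHS]card_ord -(cardC (mem I)); congr addn; apply: eq_card => i; rewrite !inE.
    by rewrite -[X in (X - _)%N]cI addKn.
  have In : (#|I| <= n)%N by apply: leq_trans (max_card _) _; rewrite card_ord.
  by rewrite -ltn_subRL subKn //; apply: leq_ltn_trans JI; rewrite subset_leq_card //; apply/fintype.subsetP.
- by rewrite ltr_wpDr ?mulr_ge0 // ltr_wpDr // ltr_wpDl.
- by rewrite ltr_wpDl.
- move=> b t Xb; have [Cy Cz _ bE _] := hX b Xb.
  have hy := hrho0 _ Cy; have hz := hrho0 _ Cz.
  have hb : `|b| <= `|b0| + r.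
    have -> : b = b0 + (b - b0) by rewrite addrC subrK.
    by apply: le_trans (ler_normD _ _) _; rewrite lerD2l ltW //; apply: Xb.1.
  have hc : `|ca b| <= `|b0| + r + (rho0 + `|p|).
    have -> : ca b = b - coord_proj J (ya b - p) by apply/eqP; rewrite eq_sym subr_eq -bE.
    apply: le_trans (ler_normB _ _) _; apply: lerD => //.
    apply: le_trans (hcp _) _; apply: le_trans (ler_normB _ _) _.
    by rewrite lerD2r.
  have p0 := normr_ge0 p; have b00 := normr_ge0 b0.
  case: t => [[i iI]|[j jJ]]; rewrite /g /=.
    apply: le_trans (normr_coord _ _) _; apply: le_trans (ler_normD _ _) _.
    lra.
  by apply: le_trans (normr_coord _ _) _; lra.
- move=> b b' d d0 Xb Xb' hd.
  have [Cy Cz sc bE hI] := hX b Xb; have [Cy' Cz' sc' bE' hI'] := hX b' Xb'.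
  have hzc i : `|((za b + ca b) - (za b' + ca b')) 0 i| <= d.
    have [iI|iI] := boolP (i \in I).
      by rewrite mxE hI // mxE hI' // subrr normr0 ltW.
    by have := hd (inl (exist _ i iI)); rewrite /g /= !mxE.
  pose P := ca b - ca b'; pose Q := za b - za b'.
  have PQ : 0 <= dotr P Q.
    have := sc _ Cz'; have := sc' _ Cz; rewrite /P /Q dotrBl.
    by rewrite -(opprB (za b')) !dotrNr; lra.
  (* Because <P, Q> >= 0, the Euclidean norm of P is at most that of P + Q, whose entries are at
     most d. The bound n d^2 is relaxed to a square so that a root can be taken. *)
  have PP : dotr P P <= (n%:R * d) ^+ 2.
    have e1 : dotr (P + Q) (P + Q) <= n%:R * d ^+ 2.
      rewrite mulr_natl -[X in _ *+ X]card_ord -sumr_const.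
      apply: ler_sum => i _; rewrite -expr2 -real_normK ?num_real //.
      rewrite lerXn2r ?nnegrE ?(ltW d0) //.
      by move: (hzc i); congr (`|_| <= _); rewrite !mxE; ring.
    have e2 : dotr P P <= dotr (P + Q) (P + Q).
      move: PQ; move: (P) (Q) => P' Q'; rewrite !(dotrDl, dotrDr) (dotrC Q' P').
      by have := dotr_ge0 Q'; lra.
    apply: le_trans e2 _; apply: le_trans e1 _.
    rewrite exprMn ler_wpM2r ?sqr_ge0 // -natrX ler_nat.
    by case: (n) => // k; rewrite -mulnn leq_pmulr.
  apply: normr_leP => [|i].
    by rewrite mulr_ge0 ?(ltW d0) // addr_ge0.
  have hPi : `|P 0 i| <= n%:R * d.
    rewrite -(@ler_pXn2r _ 2) ?nnegrE ?mulr_ge0 ?(ltW d0) //.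
    by rewrite real_normK ?num_real //; apply: le_trans (dotr_coord _ _) PP.
  have -> : (b - b') 0 i = P 0 i + (if i \in J then ya b 0 i - ya b' 0 i else 0).
    rewrite {1}bE {1}bE' !mxE; case: ifP => _; ring.
  rewrite mulrDl mul1r; apply: le_trans (ler_normD _ _) _; apply: lerD => //.
  case: ifPn => iJ; last by rewrite normr0 ltW.
  exact: (hd (inr (exist _ i iJ))).
Qed.

(** The last hypothesis expresses that p is k-extreme, in the form inherited from K by rigidity: a
    segment of C with p in its interior has its direction in U. [W] bounds the dimension of the face
    of C exposed by c. *)
Lemma asplund C p k (U : {vspace 'rV[R]_n}) e : compact C -> cvx C -> C p ->
  (\dim U <= k)%N -> 0 < e ->
  (forall a b t, C a -> C b -> 0 < t -> t < 1 -> p = (1 - t) *: a + t *: b ->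
     b - a \in U) ->
  exists y c (W : {vspace 'rV[R]_n}), [/\ C y, `|y - p| < e,
    forall z, C z -> dotr c (z - y) <= 0, (\dim W <= k)%N &
    forall z, C z -> dotr c (z - y) = 0 -> z - y \in W].
Proof.
move=> cC vC Cp Uk e0 hU.
have [J [cJ injJ _]] := vspace_coords U.
pose h z : R := \sum_(i in J) (z - p) 0 i ^+ 2.
have h0 z : h z = 0 -> forall i, i \in J -> (z - p) 0 i = 0.
  move=> /eqP; rewrite psumr_eq0 => [/allP hz i iJ|i _]; last exact: sqr_ge0.
  by have := hz i (mem_index_enum _); rewrite iJ sqrf_eq0 => /eqP.
(* The coordinates in J separate the points of U, so p is an extreme point of this slice. *)
pose A := [set z | C z /\ forall i, i \in J -> (z - p) 0 i = 0].
have cA : compact A.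
  have -> : A = C `&` [set z | 0 <= - h z].
    apply/seteqP; split=> z [Cz hz]; split=> //=.
      by rewrite /h big1 ?oppr0 // => i iJ; rewrite hz // expr0n.
    apply: h0; apply/eqP; rewrite eq_le -oppr_ge0 hz.
    by apply: sumr_ge0 => i _; apply: sqr_ge0.
  by apply: compact_setI_ge => //; apply: contN; apply: cont_sumsq.
have vA : cvx A.
  move=> a b t t0 t1 [Ca ha] [Cb hb]; split=> [|i iJ]; first exact: vC.
  have -> : ((1 - t) *: a + t *: b - p) 0 i = (1 - t) * (a - p) 0 i + t * (b - p) 0 i.
    by rewrite !mxE; ring.
  by rewrite ha // hb // !mulr0 addr0.
have [c hc] : exists c, forall z, A z -> e <= `|z - p| -> dotr c (z - p) < 0.
  apply: extreme_cap => // a b t [Ca ha] [Cb hb] t0 t1 pE.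
  apply/esym/eqP; rewrite -subr_eq0; apply/eqP; apply: injJ; first exact: hU pE.
  move=> i iJ; have := ha i iJ; have := hb i iJ; rewrite !mxE; lra.
have [b0 [r [r0 hloc]]] : exists b0 r, 0 < r /\ forall b, `|b - b0| < r ->
    forall z, C z -> e <= `|z - p| -> dotr b (z - p) - 2^-1 * h z < 0.
  by apply: (@penalized_location _ _ _ _ c) => // z Cz hz; apply: hc.
pose X I (q : 'rV[rat]_n) := [set b | `|b - b0| < r /\ exists y z c, [/\ C y, C z,
  forall w, C w -> dotr c (w - z) <= 0, b = c + coord_proj J (y - p) &
  forall i, i \in I -> (z + c) 0 i = ratr (q 0 i)]].
(* The pairs (I, q) are countable. Indices that code no pair, or a pair with |I| <= |J|, are given
   the whole space. *)
pose F i : set 'rV[R]_n := if unpickle i is Some (H, q) then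
  (if (#|J| < #|(H : {set 'I_n})|)%N then ~` closure (X H q) else setT) else setT.
have hF : forall i, open (F i) /\ dense (F i).
  have T : open (setT : set 'rV[R]_n) /\ dense (setT : set 'rV[R]_n).
    by split; [exact: openT|move=> O O0 _; rewrite setIT].
  move=> i; rewrite /F; case: unpickle => // -[I q].
  case: ifP => // JI; split; first by apply: closed_openC; exact: closed_closure.
  move=> O [b Ob] /(_ b Ob)/nbhs_ballP[s /= s0 hs].
  apply: contrapT => hO; apply: (bad_nowhere_dense (b := b) (p := p) (b0 := b0) (q := q) cC r0 JI s0).
  by move=> b' /hs Ob'; apply: contrapT => hb'; apply: hO; exists b'.
have dF := Baire hF.
have [b [bb0 Fb]] : ball b0 r `&` \bigcap_i F i !=set0.
  by apply: dF; [exists b0; exact: ballxx|exact: ball_open].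
have {}bb0 : `|b - b0| < r by move: bb0; rewrite -ball_normE /= distrC.
pose phi z := dotr b (z - p) - 2^-1 * h z.
have cphi : continuous phi.
  apply: contD; first exact: cont_dotr.
  by apply: contN; apply: contM; [exact: cont_cst|exact: cont_sumsq].
have [y Cy hy] := max_on_compact cC cphi (ex_intro _ p Cp).
have phip : phi p = 0.
  rewrite /phi /h subrr dotr0 big1 ?mulr0 ?subr0 // => i _.
  by rewrite mxE expr0n.
(* The gradient of [phi] at its maximizer y, hence a normal vector of C at y. *)
pose c' := b - coord_proj J (y - p).
have c'P z : C z -> dotr c' (z - y) <= 0.
  move=> Cz; rewrite -oppr_ge0.
  apply: (@first_order _ _ (2^-1 * \sum_(i in J) (z - y) 0 i ^+ 2)) => t t0 t1.
  have := hy _ (vC _ _ t (ltW t0) t1 Cy Cz).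
  have -> : (1 - t) *: y + t *: z = y + t *: (z - y).
    by apply/rowP => i; rewrite !mxE; ring.
  have e1 : y + t *: (z - y) - p = (y - p) + t *: (z - y) by rewrite addrAC.
  rewrite /phi e1 dotrDr dotrZr.
  have -> : h (y + t *: (z - y)) = h y +
     (2 * t * dotr (coord_proj J (y - p)) (z - y) + t ^+ 2 * \sum_(i in J) (z - y) 0 i ^+ 2).
    rewrite dotr_coord_proj /h !mulr_sumr -!big_split; apply: eq_bigr => i _ /=.
    by rewrite !mxE; ring.
  rewrite /c' dotrBl; lra.
pose S := [set z | C z /\ dotr c' (z - y) = 0].
have Sy : S y by split=> //; rewrite subrr dotr0.
have vS : cvx S.
  move=> a1 a2 t t0 t1 [C1 h1] [C2 h2]; split; first exact: vC.
  have -> : (1 - t) *: a1 + t *: a2 - y = (1 - t) *: (a1 - y) + t *: (a2 - y).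
    by apply/rowP => i; rewrite !mxE; ring.
  by rewrite dotrDr !dotrZr h1 h2 !mulr0 addr0.
have [[W hW Wk]|hW] := pselect (exists2 W : {vspace 'rV[R]_n},
    (forall z, S z -> z - y \in W) & (\dim W <= k)%N).
  exists y, c', W; split=> // [|z Cz hz]; last by apply: hW.
  rewrite ltNge; apply/negP => /(hloc b bb0 y Cy).
  by have := hy p Cp; rewrite phip /phi => h1 h2; move: (le_lt_trans h1 h2); rewrite ltxx.
(* Otherwise the exposed face S has dimension more than k. A point z of S has [c'] as a normal
   vector too, so that z, y and [c'] put b into one of the sets avoided by its choice. *)
have [|I [q [z [Ik [Cz hz] hI]]]] := @rational_hit S y c' k vS Sy.
  by move=> W hWS; rewrite ltnNge; apply/negP => Wk; apply: hW; exists W.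
have := Fb (pickle (I, q)) Logic.I; rewrite /F pickleK ifT.
  case; apply: subset_closure; split=> //; exists y, z, c'; split=> //.
    move=> w Cw; have -> : w - z = (w - y) - (z - y) by rewrite opprB addrA subrK.
    by rewrite dotrBr hz subr0; apply: c'P.
  by rewrite subrK.
by rewrite cJ; apply: leq_ltn_trans Ik.
Qed.

End Asplund.

(** * Local genericity *)

Section Genericity.
Variable R : realType.

Lemma cont_prod (T : topologicalType) (I : Type) (r : seq I) (f : I -> T -> R) :
  (forall i, continuous (f i)) -> continuous (fun z => \prod_(i <- r) f i z).
Proof.
move=> hf; elim: r => [|i r IH].
  rewrite (_ : (fun z => _) = fun=> 1); first exact: cont_cst.
  by apply/funext => z; rewrite big_nil.
rewrite (_ : (fun z => _) = fun z => f i z * \prod_(j <- r) f j z).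
  exact: contM.
by apply/funext => z; rewrite big_cons.
Qed.

Lemma cont_exp (T : topologicalType) (f : T -> R) k :
  continuous f -> continuous (fun z => f z ^+ k).
Proof.
move=> hf; elim: k => [|k IH].
  rewrite (_ : (fun z => _) = fun=> 1); first exact: cont_cst.
  by apply/funext => z; rewrite expr0.
rewrite (_ : (fun z => _) = fun z => f z * f z ^+ k); first exact: contM.
by apply/funext => z; rewrite exprS.
Qed.

Lemma qpoly_continuous N (p : mpoly N rat) : continuous (@qpoly_eval R N p).
Proof.
rewrite (_ : @qpoly_eval R N p = fun z => \sum_(m <- msupp p)
   ratr (mcoeff m p) * \prod_(i <- index_enum 'I_N) z 0 i ^+ m i) //.
apply: cont_sum => m; apply: contM; first exact: cont_cst.
by apply: cont_prod => i; apply: cont_exp; apply: coord_continuous.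
Qed.

Lemma near_lt0 N (f : 'rV[R]_N -> R) x : continuous f -> f x < 0 ->
  exists2 e, 0 < e & forall y, `|y - x| < e -> f y < 0.
Proof.
move=> cf fx.
have /nbhs_ballP[e /= e0 he] : nbhs x (f @^-1` [set t | t < 0]).
  by apply: (cf x); apply: open_nbhs_nbhs; split=> //; exact: open_lt.
by exists e => // y hy; apply: he; rewrite -ball_normE /= distrC.
Qed.

Lemma limit_ge0 N (f : 'rV[R]_N -> R) (S : set 'rV[R]_N) x : continuous f ->
  (forall e, 0 < e -> exists2 y, S y & `|y - x| < e) ->
  (forall y, S y -> 0 <= f y) -> 0 <= f x.
Proof.
move=> cf hS hf; rewrite leNgt; apply/negP => /(near_lt0 cf)[e e0 he].
by have [y /hf Sy /he] := hS e e0; rewrite ltNge Sy.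
Qed.

(* A rational polynomial that vanishes at a locally generic point vanishes near it
   on [S], so the strict inequalities of [E] persist in the limit. *)
Lemma generic_closure N (S E : set 'rV[R]_N) x : locally_generic S x ->
  semialgebraic_over_Q E ->
  (forall e, 0 < e -> exists2 y, S y /\ E y & `|y - x| < e) -> E x.
Proof.
move=> xgen [s ->] hSE.
(* Finitely many basic sets make up E, so a single one of them contains points of S arbitrarily
   close to x. *)
have [c cs hc] : exists2 c, c \in s & forall e, 0 < e ->
    exists2 y, S y /\ basic_set c y & `|y - x| < e.
  apply: contrapT => hn.
  have [e e0 he] : exists2 e, 0 < e & forall c, c \in s -> forall y,
      S y -> basic_set c y -> ~ `|y - x| < e.
    elim: s hn {hSE} => [|c s IH] hn; first by exists 1.
    have [|e e0 he] := IH.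
      by move=> [c' c's h]; apply: hn; exists c' => //; rewrite inE c's orbT.
    have [f f0 hf] : exists2 f, 0 < f & forall y, S y -> basic_set c y -> ~ `|y - x| < f.
      apply: contrapT => hf; apply: hn; exists c; first exact: mem_head.
      move=> f f0; apply: contrapT => hy; apply: hf; exists f => // y Sy cy hyf.
      by apply: hy; exists y.
    exists (Num.min e f); first by rewrite lt_min e0.
    move=> c'; rewrite inE => /orP[/eqP ->|c's] y Sy cy; rewrite lt_min => /andP[h1 h2].
      exact: hf Sy cy h2.
    exact: he c's y Sy cy h1.
  by have [y [Sy [c cs cy]] hy] := hSE e e0; exact: he cs y Sy cy hy.
have {}hc : forall e, 0 < e -> exists2 y, [set y | S y /\ basic_set c y] y & `|y - x| < e.
  by [].
exists c => //; split=> [p pc|q qc].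
  apply/eqP; rewrite eq_le; apply/andP; split.
    have cN := contN (@qpoly_continuous _ p).
    rewrite -oppr_ge0; apply: (limit_ge0 cN hc).
    by move=> y [_ [h _]]; rewrite h // oppr0.
  apply: (limit_ge0 (@qpoly_continuous _ p) hc).
  by move=> y [_ [h _]]; rewrite h.
have : 0 <= qpoly_eval q x.
  apply: (limit_ge0 (@qpoly_continuous _ q) hc).
  by move=> y [_ [_ h]]; rewrite ltW // h.
rewrite le_eqVlt => /orP[/eqP qx|//].
have [e [e0 [_ he]]] : exists e : R, 0 < e /\ generic (S `&` euclidean_ball x e) x.
  have hgen : \forall e \near (0 : R)^'+, generic (S `&` euclidean_ball x e) x.
    exact: xgen.
  by have [e [e0 he]] := filter_ex (filterI (nbhs_right_gt 0) hgen); exists e.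
(* Genericity refers to a Euclidean ball while the approximation is in the sup norm; a small enough
   sup ball lies inside the Euclidean one. *)
have [||d d0 hd] := @near_lt0 _ (fun y => \sum_i (y - x) 0 i ^+ 2 - e ^+ 2) x.
- by apply: contD; [exact: cont_sumsq|exact: cont_cst].
- by rewrite subrr big1 ?sub0r ?oppr_lt0 ?exprn_gt0 // => i _; rewrite mxE expr0n.
have [y [Sy [_ cy]] /hd hy] := hc d d0.
have := cy q qc; rewrite (he q (esym qx)) ?ltxx //; split=> //.
move: hy; rewrite subr_lt0 /euclidean_ball /=; congr (_ < _).
by apply: eq_bigr => i _; rewrite !mxE.
Qed.

End Genericity.

(** * From exposed points of the image to k-extreme points of K *)

Section Transfer.
Variables (R : realType) (m n k : nat).
Variables (K : set 'rV[R]_m) (pi : {linear 'rV[R]_m -> 'rV[R]_n}) (x : 'rV[R]_m).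

(** With the rows of G a basis of W, the pseudo-inverse of G gives coordinates on W; the partial
    identities pad the inner dimension from dim W to k. *)
Lemma vspace_factor (W : {vspace 'rV[R]_n}) : (\dim W <= k)%N ->
  exists (A : 'M[R]_(n, k)) (B : 'M[R]_(k, n)), forall v, v \in W -> v = v *m A *m B.
Proof.
move=> Wk; pose G := \matrix_(i < \dim W) (vbasis W)`_i : 'M[R]_(\dim W, n).
exists (pinvmx G *m pid_mx (\dim W)), (pid_mx (\dim W) *m G) => v vW.
have vG : (v <= G)%MS.
  apply/submxP; exists (\row_i coord (vbasis W) i v).
  rewrite {1}(coord_vbasis vW) mulmx_sum_row.
  by apply: eq_bigr => i _; rewrite mxE rowK.
have e1 : (pid_mx (\dim W) : 'M[R]_(\dim W, k)) *m
    (pid_mx (\dim W) : 'M[R]_(k, \dim W)) = 1%:M.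
  by rewrite mul_pid_mx (minn_idPl (leqnn _)) (minn_idPr Wk) pid_mx_1.
set P := pid_mx _ in e1 *; set Q := (pid_mx _ : 'M[R]_(k, \dim W)) in e1 *.
have -> : v *m (pinvmx G *m P) *m (Q *m G) = v *m pinvmx G *m (P *m Q) *m G.
  by rewrite !mulmxA.
by rewrite e1 mulmx1 mulmxKpV.
Qed.

(** For c != 0, the half-space <c, v> >= <c, pi x> meets the image exactly in the exposed face,
    which lies in pi x plus the row space of B. *)
Lemma exposing_exposed c (A : 'M[R]_(n, k)) (B : 'M[R]_(k, n)) : (0 < n)%N ->
  K x -> exposing (pi @` K) (pi x) c A B -> exposed k (pi @` K) (pi x).
Proof.
move=> n0 Kx hc; split; first by exists x.
have [c' c'0 hc'] : exists2 c' : 'rV[R]_n, c' != 0 & forall v, (pi @` K) v ->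
    dotr c' v <= dotr c' (pi x) -> dotr c (v - pi x) = 0.
  (* For c = 0 the whole image lies in that flat, so any half-space through pi x will do; 0 < n
     provides a nonzero normal vector. *)
  have [->|c0] := eqVneq c 0.
    exists (const_mx 1).
      by apply/eqP => /rowP/(_ (Ordinal n0)); rewrite !mxE => /eqP; rewrite oner_eq0.
    by move=> v _ _; rewrite -(scale0r 0) dotrZl mul0r.
  exists (- c); first by rewrite oppr_eq0.
  move=> v /hc[h _]; rewrite !dotrNl lerN2 => h'.
  by apply/eqP; rewrite eq_le h dotrBr subr_ge0.
exists [set y | dotr c' y <= dotr c' (pi x)].
  by exists c' => //; exists (dotr c' (pi x)).
split; first by rewrite /=.
pose W := span [seq row i B | i <- enum 'I_k].
apply: (@dim_leI _ _ _ (pi x) W); first by split; [exact: lexx|exists x].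
  move=> v [hv Kv]; have [_ /(_ (hc' v Kv hv)) ->] := hc v Kv.
  rewrite mulmx_sum_row; apply: memv_suml => i _; apply: memvZ; apply: memv_span.
  by apply/mapP; exists i; rewrite ?mem_enum.
by apply: leq_trans (dim_span _) _; rewrite size_map size_enum_ord.
Qed.

Hypothesis K_closed : closed K.
Hypothesis vK : cvx K.
Hypothesis x_rigid : universally_rigid K pi x.

Lemma cont_proj_dist (y : 'rV[R]_n) :
  continuous (fun z : 'rV[R]_m => `|pi z - y| : R).
Proof.
move=> z; apply: (@continuous_comp _ _ _ pi (fun v => `|v - y|)).
  exact: linear_continuous_rV.
exact: cont_dist.
Qed.

(** The ball is written as a superlevel set, the form that [closed_ge_cont] handles. *)
Lemma compact_near e : compact (K `&` [set z | - e <= - `|z - x|]).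
Proof.
apply: bounded_closed_compact.
  exists (e + `|x|); split; first exact: num_real.
  move=> M hM z [_ /=]; rewrite lerN2 => hz.
  rewrite -(subrK x z).
  by apply: le_trans (ler_normD _ _) _; apply: ltW; apply: le_lt_trans hM; rewrite lerD2r.
apply: closedI => //; apply: closed_ge_cont; apply: contN; exact: cont_dist.
Qed.

(** By rigidity the distance of the image to pi x has a positive minimum on the compact set of
    points of K at distance exactly e from x. A farther point of K can be pulled towards x onto that
    sphere, which only brings its image closer to pi x. *)
Lemma fiber_small e : 0 < e -> exists2 d, 0 < d &
  forall z, K z -> `|pi z - pi x| < d -> `|z - x| < e.
Proof.
move=> e0; have [Kx ur] := x_rigid.
pose D := (K `&` [set z | - e <= - `|z - x|]) `&` [set z | e <= `|z - x|].
have cD : compact D by apply: compact_setI_ge; [exact: compact_near|exact: cont_dist].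
have [D0|D0] := pselect (D !=set0).
  have [d [[Kd _] /= de] hd] := min_on_compact cD (@cont_proj_dist (pi x)) D0.
  exists `|pi d - pi x|.
    rewrite normr_gt0 subr_eq0; apply/eqP => h; move: de.
    by rewrite (ur d Kd h) subrr normr0 leNgt e0.
  move=> z Kz hz; rewrite ltNge; apply/negP => ez.
  have z0 : 0 < `|z - x| by apply: lt_le_trans ez.
  pose t := e / `|z - x|.
  have t0 : 0 < t by rewrite divr_gt0.
  have t1 : t <= 1 by rewrite ler_pdivrMr // mul1r.
  have wx : (1 - t) *: x + t *: z - x = t *: (z - x).
    by apply/rowP => i; rewrite !mxE; ring.
  have nw : `|(1 - t) *: x + t *: z - x| = e.
    by rewrite wx normrZ (gtr0_norm t0) mulfVK // gt_eqF.
  have : `|pi d - pi x| <= `|pi ((1 - t) *: x + t *: z) - pi x|.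
    apply: hd; split; [split; [exact: vK (ltW t0) t1 Kx Kz|]|]; by rewrite /= nw.
  have -> : pi ((1 - t) *: x + t *: z) - pi x = t *: (pi z - pi x).
    by rewrite -linearB wx linearZ linearB.
  rewrite normrZ (gtr0_norm t0).
  have : t * `|pi z - pi x| <= `|pi z - pi x| by rewrite ler_piMl.
  lra.
exists 1 => // z Kz _; rewrite ltNge; apply/negP => ez; apply: D0.
have z0 : 0 < `|z - x| by apply: lt_le_trans ez.
pose t := e / `|z - x|.
have t0 : 0 < t by rewrite divr_gt0.
have t1 : t <= 1 by rewrite ler_pdivrMr // mul1r.
have wx : (1 - t) *: x + t *: z - x = t *: (z - x).
  by apply/rowP => i; rewrite !mxE; ring.
have nw : `|(1 - t) *: x + t *: z - x| = e.
  by rewrite wx normrZ (gtr0_norm t0) mulfVK // gt_eqF.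
exists ((1 - t) *: x + t *: z).
by split; [split; [exact: vK (ltW t0) t1 Kx Kz|]|]; rewrite /= nw.
Qed.

Lemma exposing_dense : extreme_points k K x -> forall e, 0 < e ->
  exists2 y, extreme_points k K y /\ (exists c (A : 'M[R]_(n, k)) (B : 'M[R]_(k, n)),
    exposing (pi @` K) (pi y) c A B) & `|y - x| < e.
Proof.
move=> /(extreme_pointsP _ _ vK)[Kx [V hV Vk]] e e0.
have [_ ur] := x_rigid.
(* The bound 1/2 leaves room inside the unit ball of [K'] for moving a point over y towards any
   point of K. *)
pose rho := Num.min e 2^-1.
have rho0 : 0 < rho by rewrite lt_min e0 invr_gt0 ltr0n.
have [d d0 hd] := fiber_small rho0.
have hd2 z : K z -> `|pi z - pi x| < d -> `|z - x| < e /\ `|z - x| < 2^-1.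
  by move=> Kz /(hd z Kz); rewrite lt_min => /andP.
pose K' := K `&` [set z | - 1 <= - `|z - x|].
have cC : compact (pi @` K').
  apply: continuous_compact; last exact: compact_near.
  by apply: continuous_subspaceT; exact: linear_continuous_rV.
have vK' : cvx K'.
  move=> a b t t0 t1 [Ka /= ha] [Kb /= hb]; split; first exact: vK.
  rewrite /= lerN2.
  have -> : (1 - t) *: a + t *: b - x = (1 - t) *: (a - x) + t *: (b - x).
    by apply/rowP => i; rewrite !mxE; ring.
  apply: le_trans (ler_normD _ _) _; rewrite !normrZ (ger0_norm t0) ger0_norm; last lra.
  by move: ha hb; rewrite !lerN2; nra.
have vC : cvx (pi @` K').
  move=> _ _ t t0 t1 [a Ka <-] [b Kb <-]; exists ((1 - t) *: a + t *: b).
    exact: vK'.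
  by rewrite linearD !linearZ.
have Cp : (pi @` K') (pi x).
  by exists x => //; split=> //=; rewrite subrr normr0 lerN2 ler01.
have Uk : (\dim (linfun pi @: V) <= k)%N.
  by apply: leq_trans Vk; rewrite -(limg_ker_dim (linfun pi) V) leq_addl.
have [|y [c [W [[w0 [Kw0 _] w0y] yp hc Wk hW]]]] := asplund cC vC Cp Uk d0.
  (* By rigidity the point of the segment [a, b] that lies over pi x is x itself, so b - a is a
     direction of K at x and its image is in pi(V). *)
  move=> _ _ t [a [Ka _] <-] [b [Kb _] <-] t0 t1 pE.
  have xE : x = (1 - t) *: a + t *: b.
    apply/esym/ur; first by apply: vK => //; exact: ltW.
    by rewrite linearD !linearZ.
  rewrite -linearB -(lfunE pi) memv_img //; apply/hV.
  have t1' : 0 < 1 - t by rewrite subr_gt0.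
  apply: (@dirs_mid _ _ _ _ _ (1 - t) t) => //.
    by rewrite (_ : _ + _ = b) // xE; apply/rowP => i; rewrite !mxE; ring.
  by rewrite (_ : _ - _ = a) // xE; apply/rowP => i; rewrite !mxE; ring.
(* Exposedness extends from [K'] to K: a small step from w0 towards v stays in [K'], and under [pi]
   it becomes a positive multiple of pi v - y, while both conditions are homogeneous. *)
have {}hc v : K v -> dotr c (pi v - y) <= 0 /\ (dotr c (pi v - y) = 0 -> pi v - y \in W).
  move=> Kv; pose t := (2 * (1 + `|v - w0|))^-1.
  have b0 : 0 < 1 + `|v - w0| by rewrite ltr_pwDl.
  have t0 : 0 < t by rewrite invr_gt0 mulr_gt0.
  have t2 : t * `|v - w0| <= 2^-1.
    apply: (@le_trans _ _ (t * (1 + `|v - w0|))).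
      by rewrite ler_wpM2l ?(ltW t0) // lerDr.
    by rewrite /t invfM mulfVK ?gt_eqF.
  have t1 : t <= 1.
    rewrite invf_le1 ?mulr_gt0 //; have := normr_ge0 (v - w0); lra.
  have wE : (1 - t) *: w0 + t *: v = w0 + t *: (v - w0).
    by apply/rowP => i; rewrite !mxE; ring.
  have Ct : (pi @` K') (pi (w0 + t *: (v - w0))).
    exists (w0 + t *: (v - w0)) => //; split; first by rewrite -wE; apply: vK => //; exact: ltW.
    rewrite /= lerN2 addrAC; apply: le_trans (ler_normD _ _) _.
    rewrite normrZ (gtr0_norm t0).
    by have [|_ h] := hd2 w0 Kw0; [rewrite w0y|lra].
  have eE : pi (w0 + t *: (v - w0)) - y = t *: (pi v - y).
    by rewrite linearD linearZ linearB w0y addrAC subrr add0r.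
  have := hc _ Ct; have := hW _ Ct; rewrite eE dotrZr pmulr_rle0 // => h1 h2.
  split=> // h3; have := h1; rewrite h3 mulr0 => /(_ erefl) h4.
  by rewrite -[pi v - y](scalerK (lt0r_neq0 t0)) memvZ.
(* The whole fibre of K over y: by the choice of [d] it lies within 1/2 of x, so the truncation to
   [K'] loses nothing and makes it compact. *)
pose Z := K' `&` [set z | 0 <= - `|pi z - y|].
have cZ : compact Z.
  by apply: compact_setI_ge; [exact: compact_near|apply: contN; exact: cont_proj_dist].
have ZP z : Z z <-> K z /\ pi z = y.
  split=> [[[Kz _] /=]|[Kz zy]].
    by rewrite oppr_ge0 normr_le0 subr_eq0 => /eqP.
  split; last by rewrite /= zy subrr normr0 oppr0.
  split=> //=; rewrite lerN2.
  by have [|_ h] := hd2 z Kz; [rewrite zy|lra].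
have cq : continuous (fun z : 'rV[R]_m => dotr (z - 0) (z - 0)).
  by apply: cont_sum => i; apply: contM; exact: cont_coord.
have Z0 : Z !=set0 by exists w0; apply/ZP.
(* A point of maximal Euclidean norm is an extreme point of the fibre. *)
have [z Zz hz] := max_on_compact cZ cq Z0.
have [Kz zy] := (ZP z).1 Zz.
exists z; last by have [|h _] := hd2 z Kz; [rewrite zy|].
split; last first.
  have [A [B hAB]] := vspace_factor Wk.
  exists c, A, B => _ [v Kv <-]; rewrite zy; have [h1 h2] := hc v Kv.
  by split=> // /h2; apply: hAB.
apply/(extreme_pointsP _ _ vK); split=> //.
have [D hD] := dirs_vspace vK Kz; exists D => //; apply: leq_trans Wk.
(* [pi] maps the directions at z into W, since c is at most 0 on both pi v and - pi v and hence
   vanishes there; it remains to see that [pi] is injective on these directions. *)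
rewrite -(@limg_dim_eq _ _ _ (linfun pi)).
  apply: dimvS; apply/subvP => _ /memv_imgP[v /hD[t [t0 h1 h2]] ->]; rewrite lfunE.
  have [] := hc _ h1; have [] := hc _ h2.
  have e1 : pi (z + t *: v) - y = t *: pi v.
    by rewrite linearD linearZ zy addrAC subrr add0r.
  have e2 : pi (z - t *: v) - y = - (t *: pi v).
    by rewrite linearB linearZ zy addrAC subrr add0r.
  rewrite e1 e2 dotrNr oppr_le0 => k1 _ k2 k3.
  rewrite -[pi v](scalerK (lt0r_neq0 t0)) memvZ //; apply: k3.
  by apply/eqP; rewrite eq_le k1 k2.
(* A direction v killed by [pi] keeps z + t v and z - t v in the fibre; adding the two norm
   inequalities gives t^2 |v|^2 <= 0. *)
apply/eqP; rewrite -subv0; apply/subvP => v; rewrite memv_cap memv_ker lfunE.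
move=> /andP[/hD[t [t0 h1 h2]] /eqP pv]; rewrite memv0; apply/eqP/dotr_eq0.
have Z1 : Z (z + t *: v).
  by apply/ZP; split=> //; rewrite linearD linearZ /= pv scaler0 addr0.
have Z2 : Z (z - t *: v).
  by apply/ZP; split=> //; rewrite linearB linearZ /= pv scaler0 subr0.
have := hz _ Z1; have := hz _ Z2; rewrite !subr0.
rewrite !(dotrDl, dotrDr, dotrNl, dotrNr, dotrZl, dotrZr) (dotrC v z).
move=> k1 k2; apply/eqP; rewrite eq_le dotr_ge0 andbT.
have : t * (t * dotr v v) <= 0 by lra.
by rewrite !pmulr_rle0.
Qed.

End Transfer.

Theorem theorem2 (R : realType) (m n k : nat)
    (K : set 'rV[R]_m) (pi : {linear 'rV[R]_m -> 'rV[R]_n}) (x : 'rV[R]_m)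
    (hn : (0 < n)%N)
    (hK_closed : closed K)
    (hK_line_free : line_free K)
    (hK_convex : convex_set K)
    (hK_semialg : semialgebraic_over_Q K)
    (hpi_surj : forall z : 'rV[R]_n, exists y : 'rV[R]_m, pi y = z)
    (hpi_rat : linear_over_Q pi)
    (hxK : K x)
    (hx_gen : locally_generic (extreme_points k K) x)
    (hx_ur : universally_rigid K pi x) :
  exposed k (pi @` K) (pi x).
Proof.
have vK : cvx K by apply/convex_setP.
(* Being generic in a set includes membership in it. *)
have xext : extreme_points k K x.
  have hgen : \forall e \near (0 : R)^'+, generic (extreme_points k K `&` euclidean_ball x e) x.
    exact: hx_gen.
  by have [e [_ [[Sx _] _]]] := filter_ex (filterI (nbhs_right_gt 0) hgen).
have [c [A [B h]]] := generic_closure hx_gen (SA_exposing k hK_semialg hpi_rat)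
  (exposing_dense hK_closed vK hx_ur xext).
exact: exposing_exposed hn hxK h.
Qed.
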